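(* Consider the semi-discrete Navier--Stokes type differential-algebraic equation (DAE) $$M\dot v+K(v)-B^{T}p=f,\qquad Bv=g,$$ for the unknowns $v(t)\in\mathbb R^n$, $p(t)\in\mathbb R^m$, $m<n$, where $M\in\mathbb R^{n\times n}$ is symmetric positive definite, $K:\mathbb R^n\to\mathbb R^n$ is a possibly nonlinear map on which no assumptions are imposed, and $B\in\mathbb R^{m\times n}$ is allowed to be rank-deficient. This DAE has strangeness index one. Consequently, its differentiation index equals $2$ whenever it is well-defined, i.e., whenever $B$ is of full rank. In detail: (i) (Linear case.) If $K(v)=Kv$ with a matrix $K\in\mathbb R^{n\times n}$, then the matrix pair $$(E,A)=\left(\begin{bmatrix} M & 0 \\ 0 & 0\end{bmatrix},\ \begin{bmatrix} -K & B^{T} \\ B & 0\end{bmatrix}\right)$$ has strangeness index one. (ii) (Nonlinear case, $\operatorname{rank}B=m$.) The DAE satisfies the strangeness hypothesis with $\mu=1$, $a=2m$, $d=n-m$, and does not satisfy it with $\mu=0$; hence it has strangeness index one. (iii) (Nonlinear case, $b:=\operatorname{rank}B<m$.) Let $C_0\in\mathbb R^{m\times(m-b)}$ be of full rank with $B^TC_0=0$, let $C'\in\mathbb R^{m\times b}$ be any matrix such that $C=[C_0\ \ C']\in\mathbb R^{m\times m}$ is invertible, and write $B^TC=[0\ \ \tilde B^T]$, where $\tilde B\in\mathbb R^{b\times n}$ has full rank. With $\tilde p:=C^{-1}p$ and multiplication of the constraint by $C^T$, the DAE is equivalent to $$M\dot v+K(v)-\begin{bmatrix}0 & \tilde B^T\end{bmatrix}\tilde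 p=f,\qquad \begin{bmatrix}0\\ \tilde B\end{bmatrix}v=C^Tg.$$ Assuming that the DAE is solvable, so that the $m-b$ consistency equations $0=g_1$ (with $g_1$ the first $m-b$ components of $C^Tg$) are vanishing equations, these equations and the first $m-b$ components of $\tilde p$, which are underdetermined and do not influence the system, may be omitted without changing the index. What remains is a system of the original form with the full-rank matrix $\tilde B$ in place of $B$, to which (ii) applies (with $b$ in place of $m$). Hence the DAE has strangeness index one also in this case.
   Context: The DAE arises from a spatial discretization of the incompressible Navier--Stokes equations: $v$ and $p$ are the discrete velocity and pressure, $M$ is the mass matrix, $K$ discretizes the convection and diffusion terms, $B$ the divergence, and $f$, $g$ are given time-dependent right-hand sides. The initial value $v(0)=v_0$ is assumed consistent, i.e. $Bv_0=g(0)$. Strangeness index of a constant matrix pair. Two pairs of $\ell\times k$ matrices $(E,A)$ and $(\tilde E,\tilde A)$ are equivalent if $\tilde E=PEQ$, $\tilde A=PAQ$ with nonsingular matrices $P,Q$. Every constant pair is equivalent to a pair of the form $$\left(\begin{bmatrix} I_s & 0 & 0 & 0 \\ 0 & I_d & 0 & 0 \\ 0 & 0 & 0 & 0 \\ 0 & 0 & 0 & 0 \\ 0 & 0 & 0 & 0\end{bmatrix},\ \begin{bmatrix} 0 & A_{12} & 0 & A_{14} \\ 0 & A_{22} & 0 & A_{24} \\ 0 & 0 & I_a & 0 \\ I_s & 0 & 0 & 0 \\ 0 & 0 & 0 & 0\end{bmatrix}\right),$$ in which blocks may have zero rows or columns and $s,d,a$ are uniquely determined by $(E,A)$; $s$ is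 the strangeness of the pair. One reduction step replaces the block $I_s$ in the first matrix by $0$ and leaves the second matrix unchanged (this corresponds to eliminating $\dot x_1$ from the first block row using the derivative of the fourth block row). Iterating from $(E_0,A_0)=(E,A)$ gives pairs $(E_i,A_i)$ with strangeness $s_i$. The strangeness index of $(E,A)$ is $\min\{i\ge 0: s_i=0\}$. Strangeness index of a nonlinear square DAE. Let $F(t,x,\dot x)=0$ be a DAE with $N$ equations and $x(t)\in\mathbb R^N$; here $x=[v^T,p^T]^T$. Let $F_\mu(t,x,\dot x,\dots,x^{(\mu+1)})$ be the stack of $F$ and its total time derivatives up to order $\mu$. Let $M_\mu$ be the Jacobian of $F_\mu$ with respect to $(\dot x,\dots,x^{(\mu+1)})$, and let $N_\mu=-[\partial F_\mu/\partial x,\ 0,\dots,0]$, with the same number of columns as $(x,\dot x,\dots,x^{(\mu)})$ has components. Set $\mathbb L_\mu=\{(t,x,\dot x,\dots,x^{(\mu+1)}): F_\mu=0\}$. The strangeness hypothesis (Kunkel--Mehrmann) with integers $\mu,a,d$ requires that $\mathbb L_\mu\neq\emptyset$ and that every point of $\mathbb L_\mu$ has a neighborhood in which the following hold on $\mathbb L_\mu$: (1) $\operatorname{rank}M_\mu=(\mu+1)N-a$, and there is a smooth matrix function $Z_2$ of size $(\mu+1)N\times a$ and pointwise full rank with $Z_2^{T}M_\mu=0$; (2) $\hat A_2:=Z_2^{T}N_\mu[I_N\ 0\ \cdots\ 0]^{T}$ has rank $a$, and there is a smooth matrix function $T_2$ of size $N\times d$, $d=N-a$, of pointwise full rank with $\hat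 A_2T_2=0$; (3) $\operatorname{rank}(F_{\dot x}T_2)=d$, and there is a smooth matrix function $Z_1$ of size $N\times d$ and pointwise full rank with $\operatorname{rank}(Z_1^{T}F_{\dot x}T_2)=d$. The hypothesis is satisfied with $\mu$ if such $a,d$ exist. The strangeness index of the DAE is the smallest $\mu$ for which the hypothesis is satisfied. The differentiation index is the smallest number of times the DAE has to be differentiated so that an explicit ordinary differential equation for all of its unknowns can be extracted from the equations and their derivatives; it is not well-defined if $B$ is rank-deficient.
   Formalization: B is assumed nonzero (for B = 0 the index is 0, so the claim fails), and K, f, g are assumed infinitely differentiable, since the derivative arrays and the smooth matrix functions in the strangeness hypothesis are otherwise undefined or need not exist. *)

(* Defs.v *)
From HB Require Import structures.
From mathcomp Require Export all_boot all_order all_algebra.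
From mathcomp Require Export all_classical all_reals all_analysis.
Export Order.TTheory GRing.Theory Num.Theory.
Export numFieldNormedType.Exports.

Set Implicit Arguments.
Unset Strict Implicit.
Unset Printing Implicit Defensive.

Local Open Scope classical_set_scope.
Local Open Scope ring_scope.

Definition is_least (P : nat -> Prop) (k : nat) : Prop :=
  P k /\ forall i, (i < k)%N -> ~ P i.

(* Nonsingular matrix whose row and column numbers are only provably equal
   (being row free and row full forces k = l); this avoids casts between the
   sizes of the blocks and the size of the whole matrix. *)
Definition nonsingular {R : fieldType} {k l : nat} (P : 'M[R]_(k, l)) : bool :=
  row_free P && row_full P.

(* The rows of the canonical form have block sizes s, d, a, s, z and its columns
   s, d, a, u. *)
Section CanonicalForm.
Variables (R : fieldType) (s d a u z : nat).

Definition canE : 'M[R]_(s + (d + (a + (s + z))), s + (d + (a + u))) :=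
  block_mx 1%:M 0 0 (block_mx 1%:M 0 0 0).

(* canE with the block I_s replaced by 0 *)
Definition canE_reduced : 'M[R]_(s + (d + (a + (s + z))), s + (d + (a + u))) :=
  block_mx 0 0 0 (block_mx 1%:M 0 0 0).

Definition canA (A12 : 'M[R]_(s, d)) (A14 : 'M[R]_(s, u))
    (A22 : 'M[R]_(d, d)) (A24 : 'M[R]_(d, u)) :
    'M[R]_(s + (d + (a + (s + z))), s + (d + (a + u))) :=
  col_mx (row_mx 0 (row_mx A12 (row_mx 0 A14)))
 (col_mx (row_mx 0 (row_mx A22 (row_mx 0 A24)))
 (col_mx (row_mx 0 (row_mx 0 (row_mx 1%:M 0)))
 (col_mx (row_mx 1%:M 0)
          0))).

End CanonicalForm.

Definition pair_equiv {R : fieldType} {l k l' k' : nat}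
    (E A : 'M[R]_(l, k)) (E' A' : 'M[R]_(l', k')) : Prop :=
  exists (P : 'M[R]_(l', l)) (Q : 'M[R]_(k, k')),
    [/\ nonsingular P, nonsingular Q, E' = P *m E *m Q & A' = P *m A *m Q].

(* iterated_strangeness E A i s: the pair (E_i, A_i) reached from (E, A) after i
   reduction steps has strangeness s. *)
Inductive iterated_strangeness (R : fieldType) :
    forall l k : nat, 'M[R]_(l, k) -> 'M[R]_(l, k) -> nat -> nat -> Prop :=
| strangeness_here l k (E A : 'M[R]_(l, k)) s d a u z A12 A14 A22 A24 :
    pair_equiv E A (canE R s d a u z) (canA a z A12 A14 A22 A24) ->
    iterated_strangeness E A 0 s
| strangeness_step l k (E A : 'M[R]_(l, k)) s d a u z A12 A14 A22 A24 i s' :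
    pair_equiv E A (canE R s d a u z) (canA a z A12 A14 A22 A24) ->
    iterated_strangeness (canE_reduced R s d a u z)
      (canA a z A12 A14 A22 A24) i s' ->
    iterated_strangeness E A i.+1 s'.

Definition pair_strangeness_index {R : fieldType} {l k : nat}
    (E A : 'M[R]_(l, k)) (nu : nat) : Prop :=
  is_least (fun i => iterated_strangeness E A i 0) nu.

Fixpoint Ck_on {R : realType} {V W : normedModType R}
    (U : set V) (k : nat) (f : V -> W) : Prop :=
  match k with
  | 0 => forall x, U x -> {for x, continuous f}
  | k'.+1 => (forall x, U x -> differentiable f x) /\
             forall h : V, Ck_on U k' (fun x => 'd f x h)
  end.

(* To be used with U open. For maps between finite-dimensional spaces this is the
   usual class C^oo. *)
Definition smooth_on {R : realType} {V W : normedModType R}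
    (U : set V) (f : V -> W) : Prop :=
  forall k, Ck_on U k f.

(* The DAE F(t, x, x') = 0 *)
Definition dae (R : realType) (N : nat) : Type :=
  R -> 'cV[R]_N -> 'cV[R]_N -> 'cV[R]_N.

(* (t, x, x', ..., x^(k-1)), the transpose of x^(j) being the j-th row of the
   matrix *)
Notation jet R N k := (R * 'M[R]_(k, N))%type.

Section DerivativeArrays.
Variables (R : realType) (N : nat) (F : dae R N).

(* i-th total time derivative of F. The recursive clause is
   D_t G (t, x, ..., x^(i+2)) = G_t + G_x x' + ... + G_(x^(i+1)) x^(i+2). *)
Fixpoint total_derivative (i : nat) : jet R N i.+2 -> 'cV[R]_N :=
  match i return jet R N i.+2 -> 'cV[R]_N with
  | 0 => fun z => F z.1 (row ord0 z.2)^T (row ord_max z.2)^T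
  | i'.+1 => fun z =>
      'd (total_derivative (i := i')) (z.1, row' ord_max z.2)
        (1, row' ord0 z.2)
  end.

(* F_mu; its i-th row is the transpose of the i-th total derivative *)
Definition derivative_array (mu : nat) (z : jet R N mu.+2) : 'M[R]_(mu.+1, N) :=
  \matrix_(i < mu.+1) (total_derivative (i := i)
    (z.1, rowsub (fun j : 'I_i.+2 => inord j : 'I_mu.+2) z.2))^T.

(* L_mu, with t restricted to the time interval I *)
Definition jet_solutions (I : set R) (mu : nat) : set (jet R N mu.+2) :=
  [set z | I z.1 /\ derivative_array z = 0].
Arguments jet_solutions I mu : clear implicits.

(* The library's jacobian acts on row vectors and is thus the transpose of the
   usual Jacobian matrix. mxvec stacks the rows, i.e. the blocks x^(j) and the
   total derivatives of F, in increasing order. *)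
Definition array_M (mu : nat) (z : jet R N mu.+2) : 'M[R]_(mu.+1 * N) :=
  (jacobian (fun y : 'rV[R]_(mu.+1 * N) =>
     mxvec (derivative_array (z.1, col_mx (row ord0 z.2) (vec_mx y) : 'M[R]_(mu.+2, N))))
   (mxvec (row' ord0 z.2)))^T.

Definition array_x (mu : nat) (z : jet R N mu.+2) : 'M[R]_(mu.+1 * N, N) :=
  (jacobian (fun x : 'rV[R]_N =>
     mxvec (derivative_array (z.1, col_mx x (row' ord0 z.2) : 'M[R]_(mu.+2, N))))
   (row ord0 z.2))^T.

Definition array_N (mu : nat) (z : jet R N mu.+2) :
    'M[R]_(mu.+1 * N, N + mu * N) :=
  - row_mx (array_x z) 0.

(* F_(x') at the point (t, x, x') underlying z *)
Definition jac_xdot (mu : nat) (z : jet R N mu.+2) : 'M[R]_N :=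
  let x := row ord0 z.2 in
  let xdot := row (lift ord0 ord0) z.2 in
  (jacobian (fun y : 'rV[R]_N => (F z.1 x^T y^T)^T) xdot)^T.

Definition strangeness_hypothesis_with (I : set R) (mu a d : nat) : Prop :=
  [/\ (d + a = N)%N,
      jet_solutions I mu !=set0
    & forall z0, jet_solutions I mu z0 ->
      exists (U : set (jet R N mu.+2))
             (Z2 : jet R N mu.+2 -> 'M[R]_(mu.+1 * N, a))
             (T2 : jet R N mu.+2 -> 'M[R]_(N, d))
             (Z1 : jet R N mu.+2 -> 'M[R]_(N, d)),
      [/\ open U /\ U z0,
          [/\ smooth_on U Z2, smooth_on U T2 & smooth_on U Z1]
        & forall z, jet_solutions I mu z -> U z ->
          let A2 := (Z2 z)^T *m array_N z *m col_mx 1%:M 0 in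
          [/\ [/\ (\rank (array_M z) + a = mu.+1 * N)%N,
                  \rank (Z2 z) = a & (Z2 z)^T *m array_M z = 0],
              [/\ \rank A2 = a, \rank (T2 z) = d & A2 *m T2 z = 0]
            & [/\ \rank (jac_xdot z *m T2 z) = d, \rank (Z1 z) = d
                & \rank ((Z1 z)^T *m jac_xdot z *m T2 z) = d]]]].

Definition strangeness_hypothesis (I : set R) (mu : nat) : Prop :=
  exists a d, strangeness_hypothesis_with I mu a d.

Definition strangeness_index (I : set R) (nu : nat) : Prop :=
  is_least (strangeness_hypothesis I) nu.

(* The equations F_nu = 0 have a solution and imply an explicit ODE
   x' = phi(t, x). *)
Definition yields_explicit_ode (I : set R) (nu : nat) : Prop :=
  jet_solutions I nu !=set0 /\
  exists (D : set (R * 'cV[R]_N)) (phi : R * 'cV[R]_N -> 'cV[R]_N),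
    [/\ open D, smooth_on D phi
      & forall z, jet_solutions I nu z ->
        let x := (row ord0 z.2)^T in
        let xdot := (row (lift ord0 ord0) z.2)^T in
        D (z.1, x) /\ xdot = phi (z.1, x)].

Definition differentiation_index (I : set R) (nu : nat) : Prop :=
  is_least (yields_explicit_ode I) nu.

End DerivativeArrays.

(* G arises from F by nonsingular constant changes of the unknowns and of the
   equations, and by then omitting k equations which vanish identically on I
   together with k unknowns which do not occur in the remaining equations. *)
Definition omits_redundancy {R : realType} {N N' : nat} (I : set R)
    (F : dae R N) (G : dae R N') : Prop :=
  exists k (P : 'M[R]_(k + N', N)) (Q : 'M[R]_(N, k + N')) (h : R -> 'cV[R]_k),
    [/\ nonsingular P, nonsingular Q, forall t, I t -> h t = 0
      & forall t (y0 ydot0 : 'cV[R]_k) (y ydot : 'cV[R]_N'),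
        P *m F t (Q *m col_mx y0 y) (Q *m col_mx ydot0 ydot) =
        col_mx (h t) (G t y ydot)].

(* Strangeness index of a DAE that may contain vanishing equations and
   underdetermined unknowns which do not influence the system: the strangeness
   hypothesis is imposed on what remains after these have been omitted. *)
Definition strangeness_index_mod_redundancy {R : realType} {N : nat}
    (F : dae R N) (I : set R) (nu : nat) : Prop :=
  is_least (fun mu => exists N' (G : dae R N'),
    omits_redundancy I F G /\ strangeness_hypothesis G I mu) nu.

Section NavierStokes.
Variables (R : realType) (n m : nat).
Variables (M : 'M[R]_n) (K : 'cV[R]_n -> 'cV[R]_n) (B : 'M[R]_(m, n)).
Variables (f : R -> 'cV[R]_n) (g : R -> 'cV[R]_m).

(* The DAE in the unknown x = [v; p] *)
Definition ns_dae : dae R (n + m) := fun t x xdot =>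
  let v := usubmx x in let p := dsubmx x in let vdot := usubmx xdot in
  col_mx (M *m vdot + K v - B^T *m p - f t) (B *m v - g t).

Definition ns_solution (I : set R) (v : R -> 'cV[R]_n) (p : R -> 'cV[R]_m) : Prop :=
  forall t, I t ->
    [/\ derivable v t 1,
        M *m derive1 v t + K (v t) - B^T *m p t = f t
      & B *m v t = g t].

Definition ns_solvable (I : set R) : Prop := exists v p, ns_solution I v p.

End NavierStokes.

(* Main.v *)
From HB Require Import structures.
Require Import Defs.

Set Implicit Arguments.
Unset Strict Implicit.
Unset Printing Implicit Defensive.

Local Open Scope classical_set_scope.
Local Open Scope ring_scope.

(** The algebraic core is a test for vanishing strangeness that mentions no
    canonical form, [strangeness_free]: if w runs over the left kernel of E, then
    w A vanishes as soon as it vanishes on the kernel of E. In words, an algebraic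
    equation w A x = w f that contains no algebraic unknown contains no unknown at
    all. The test is invariant under equivalence and
    characterizes s = 0 ([iterated_strangeness0]). For the Navier-Stokes pencil the
    left kernel of E picks out the rows of the constraint B v = g, which involves
    v only; so the test fails exactly because B is not zero. After one reduction
    step the unknown p acts through B M^-1 B^T, which is definite on the row space
    of B since M is positive definite, and the test succeeds ([ns_pencil_index]).

    The same test disposes of the index 0 in the nonlinear case. If the
    strangeness hypothesis holds with mu = 0, then Z_2 spans the left kernel of
    F_x' and T_2 spans a complement of its kernel, whence (F_x', F_x) passes the
    test at some point ([hypothesis0_strangeness_free]). An admissible removal of
    redundancies changes this pencil by an equivalence and the deletion of zero
    rows and columns, so it cannot help ([hypothesis0_redundancy]).

    For mu = 1 everything is explicit. The i-th total derivative of the DAE is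
    M v^(i+1) + Phi_i(v, ..., v^(i)) - B^T p^(i) - f^(i) together with
    B v^(i) - g^(i) ([total_derivativeE]). Combining the first two levels with the
    constant matrix [[0, I, 0, 0], [B M^-1, 0, 0, -I]] leaves the constraint
    B v = g and the hidden constraint
    B M^-1 (K(v) - B^T p - f) + g' = 0. If B has full rank m, then B M^-1 B^T is
    invertible, these are 2 m independent equations in x = (v, p), and the
    directions they leave free are parametrized by the kernel of B
    ([ns_strangeness_hypothesis1]).

    For the differentiation index, v' comes from the first equation, and p' from
    the derivative of the hidden constraint, which needs the second derivative of
    B v = g ([ns_explicit_ode]). One level lower p' is not determined, because
    M v'' - B^T p' only fixes v'' in terms of p' ([no_explicit_ode]); and if B is
    rank-deficient, then no number of derivatives sees the part of p' in the kernel
    of B^T ([no_explicit_ode_deficient]).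

    If rank B = b < m, a basis of R^m adapted to the kernel of B^T turns the DAE
    into one with a full-rank B, to which the above applies. *)

Local Notation mx_simp :=
  (mulmx0, mul0mx, mulmx1, mul1mx, addr0, add0r, subr0, oppr0) (only parsing).

(** * Strangeness of matrix pairs *)
Section Pencils.
Variable F : fieldType.

Lemma row_mx0P l k1 k2 (A1 : 'M[F]_(l, k1)) (A2 : 'M[F]_(l, k2)) :
  row_mx A1 A2 = 0 -> A1 = 0 /\ A2 = 0.
Proof. by rewrite -row_mx0 => /eq_row_mx. Qed.

Lemma col_mx0P l1 l2 k (A1 : 'M[F]_(l1, k)) (A2 : 'M[F]_(l2, k)) :
  col_mx A1 A2 = 0 -> A1 = 0 /\ A2 = 0.
Proof. by rewrite -col_mx0 => /eq_col_mx. Qed.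

Lemma nonsingularP l k (P : 'M[F]_(l, k)) :
  reflect (exists P' : 'M[F]_(k, l), P *m P' = 1%:M /\ P' *m P = 1%:M)
          (nonsingular P).
Proof.
apply: (iffP andP) => [[/row_freeP[X PX] /row_fullP[Y YP]]|[P' [h1 h2]]].
  exists X; split=> //.
  by rewrite -[X]mul1mx -YP -!mulmxA [P *m (X *m P)]mulmxA PX mul1mx YP.
by split; [apply/row_freeP; exists P' | apply/row_fullP; exists P'].
Qed.

Lemma nonsingular_unitmx l (P : 'M[F]_l) : P \in unitmx -> nonsingular P.
Proof. by move=> uP; rewrite /nonsingular row_free_unit row_full_unit uP. Qed.

Lemma nonsingularM l k p (P : 'M[F]_(l, k)) (Q : 'M[F]_(k, p)) :
  nonsingular P -> nonsingular Q -> nonsingular (P *m Q).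
Proof.
move=> /nonsingularP[P' [PP' P'P]] /nonsingularP[Q' [QQ' Q'Q]].
apply/nonsingularP; exists (Q' *m P'); split.
  by rewrite mulmxA -[P *m Q *m Q']mulmxA QQ' mulmx1.
by rewrite mulmxA -[Q' *m P' *m P]mulmxA P'P mulmx1.
Qed.

Lemma nonsingular1 l : nonsingular (1%:M : 'M[F]_l).
Proof. by apply/nonsingular_unitmx/unitmx1. Qed.

Lemma nonsingular_upper l1 l2 k1 k2 (P1 : 'M[F]_(l1, k1)) (P2 : 'M[F]_(l2, k2)) X :
  nonsingular P1 -> nonsingular P2 -> nonsingular (block_mx P1 X 0 P2).
Proof.
move=> /nonsingularP[Q1 [h1 h1']] /nonsingularP[Q2 [h2 h2']].
apply/nonsingularP; exists (block_mx Q1 (- (Q1 *m X *m Q2)) 0 Q2).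
rewrite !mulmx_block !mulmx0 !mul0mx !addr0 !add0r h1 h1' h2 h2'.
rewrite mulmxN mulNmx !mulmxA h1 mul1mx addNr.
by rewrite -!mulmxA h2' !mulmxA mulmx1 subrr -!scalar_mx_block.
Qed.

Lemma nonsingular_lower l1 l2 k1 k2 (P1 : 'M[F]_(l1, k1)) (P2 : 'M[F]_(l2, k2)) X :
  nonsingular P1 -> nonsingular P2 -> nonsingular (block_mx P1 0 X P2).
Proof.
move=> /nonsingularP[Q1 [h1 h1']] /nonsingularP[Q2 [h2 h2']].
apply/nonsingularP; exists (block_mx Q1 0 (- (Q2 *m X *m Q1)) Q2).
rewrite !mulmx_block !mulmx0 !mul0mx !addr0 !add0r h1 h1' h2 h2'.
rewrite mulmxN mulNmx !mulmxA h2 mul1mx subrr.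
by rewrite -!mulmxA h1' !mulmxA mulmx1 addNr -!scalar_mx_block.
Qed.

Lemma pair_equiv_trans l1 k1 l2 k2 l3 k3 (E1 A1 : 'M[F]_(l1, k1))
    (E2 A2 : 'M[F]_(l2, k2)) (E3 A3 : 'M[F]_(l3, k3)) :
  pair_equiv E1 A1 E2 A2 -> pair_equiv E2 A2 E3 A3 -> pair_equiv E1 A1 E3 A3.
Proof.
move=> [P [Q [nP nQ -> ->]]] [P' [Q' [nP' nQ' -> ->]]].
exists (P' *m P), (Q *m Q'); rewrite !nonsingularM //; split=> //;
by rewrite !mulmxA.
Qed.

Lemma pair_equiv_sym l k l' k' (E A : 'M[F]_(l, k)) (E' A' : 'M[F]_(l', k')) :
  pair_equiv E A E' A' -> pair_equiv E' A' E A.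
Proof.
move=> [P [Q [/nonsingularP[P' [h1 h1']] /nonsingularP[Q' [h2 h2']] -> ->]]].
exists P', Q'; split.
- by apply/nonsingularP; exists P.
- by apply/nonsingularP; exists Q.
- by rewrite !mulmxA h1' mul1mx -mulmxA h2 mulmx1.
- by rewrite !mulmxA h1' mul1mx -mulmxA h2 mulmx1.
Qed.

Lemma pair_equiv_cast l k l' k' (e : (l = l') * (k = k')) (E A : 'M[F]_(l, k)) :
  pair_equiv E A (castmx e E) (castmx e A).
Proof.
case: e => el ek; case: l' / el; case: k' / ek; exists 1%:M, 1%:M.
by rewrite !nonsingular1 !castmx_id !mul1mx !mulmx1.
Qed.

(** Canonical-form-free version of s = 0: if the columns of Z and T are bases of the
    left kernel and of the kernel of E, then c Z^T A T = 0 implies c Z^T A = 0. *)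
Definition strangeness_free l k (E A : 'M[F]_(l, k)) : Prop :=
  forall w : 'rV[F]_l, w *m E = 0 ->
    (forall x : 'cV[F]_k, E *m x = 0 -> w *m A *m x = 0) -> w *m A = 0.

Lemma strangeness_free_equiv l k l' k' (E A : 'M[F]_(l, k))
    (E' A' : 'M[F]_(l', k')) :
  pair_equiv E A E' A' -> strangeness_free E A -> strangeness_free E' A'.
Proof.
move=> [P [Q [/nonsingularP[P' [h1 h1']] /nonsingularP[Q' [h2 h2']] -> ->]]].
move=> free w wE wA; rewrite !mulmxA [X in X *m Q]free ?mul0mx //.
  by rewrite -[LHS]mulmx1 -h2 !mulmxA -[w *m P *m E]mulmxA -[_ *m Q]mulmxA wE mul0mx.
move=> x Ex; have := wA (Q' *m x).
rewrite -!mulmxA [Q *m (Q' *m x)]mulmxA h2 mul1mx Ex mulmx0 => /(_ erefl).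
by rewrite !mulmxA.
Qed.

(** The complementary sizes l2 and k2 are quantified instead of being written as
    differences, so that block decompositions need no casts. *)
Lemma rank_normal_form l k (E : 'M[F]_(l, k)) :
  exists l2 k2 (P : 'M[F]_(\rank E + l2, l)) (Q : 'M[F]_(k, \rank E + k2)),
    [/\ nonsingular P, nonsingular Q & P *m E *m Q = block_mx 1%:M 0 0 0].
Proof.
have := mulmx_ebase E; have := row_ebase_unit E; have := col_ebase_unit E.
have := rank_leq_row E; have := rank_leq_col E.
move: (\rank E) (col_ebase E) (row_ebase E) => r L U /subnKC ek /subnKC el.
move: (k - r)%N (l - r)%N ek el => k2 l2 ek el.
case: k / ek E U => E U; case: l / el E L => E L uL uU <-.
exists l2, k2, (invmx L), (invmx U).
rewrite !nonsingular_unitmx ?unitmx_inv //; split=> //.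
by rewrite !mulmxA mulVmx // mul1mx mulmxK // pid_mx_block.
Qed.

(** Blocks with s = 0 rows or columns disappear up to conversion of 0 + n to n;
    the next lemmas rely on this and state no cast. *)
Lemma block_mx_nil l k (Aul : 'M[F]_(0, 0)) Aur Adl (Adr : 'M[F]_(l, k)) :
  block_mx Aul Aur Adl Adr = Adr.
Proof.
apply/matrixP => i j.
have -> : block_mx Aul Aur Adl Adr i j =
          block_mx Aul Aur Adl Adr (rshift 0 i) (rshift 0 j).
  by congr (block_mx _ _ _ _ _ _); apply: val_inj.
by rewrite block_mxEdr.
Qed.

Lemma col_mx_nil l k (Au : 'M[F]_(0, k)) (Ad : 'M[F]_(l, k)) : col_mx Au Ad = Ad.
Proof.
apply/matrixP => i j.
have -> : col_mx Au Ad i j = col_mx Au Ad (rshift 0 i) j.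
  by congr (col_mx _ _ _ _); apply: val_inj.
by rewrite col_mxEd.
Qed.

Lemma row_mx_nil l k (Al : 'M[F]_(l, 0)) (Ar : 'M[F]_(l, k)) : row_mx Al Ar = Ar.
Proof.
apply/matrixP => i j.
have -> : row_mx Al Ar i j = row_mx Al Ar i (rshift 0 j).
  by congr (row_mx _ _ _ _); apply: val_inj.
by rewrite row_mxEr.
Qed.

Lemma canE_nil d a u z :
  canE F 0 d a u z = block_mx 1%:M 0 0 0 :> 'M[F]_(d + (a + z), d + (a + u)).
Proof. exact: block_mx_nil. Qed.

Lemma canA_nil d a u z A12 A14 (A22 : 'M[F]_d) (A24 : 'M[F]_(d, u)) :
  canA a z (A12 : 'M[F]_(0, d)) A14 A22 A24 =
  block_mx A22 (row_mx 0 A24) 0 (block_mx 1%:M 0 0 0) :> 'M[F]_(d + (a + z), d + (a + u)).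
Proof.
rewrite /canA col_mx_nil !row_mx_nil.
rewrite [col_mx _ 0](_ : _ = 0); last exact: col_mx_nil.
rewrite [in RHS]/block_mx; congr col_mx.
transitivity (block_mx (0 : 'M[F]_(a, d)) (row_mx 1%:M 0 : 'M[F]_(a, a + u))
  (0 : 'M[F]_(z, d)) 0).
  by rewrite /block_mx row_mx0.
by rewrite block_mxEh col_mx0; congr row_mx; rewrite /block_mx row_mx0.
Qed.

Lemma strangeness_free_canon d a u z A12 A14 (A22 : 'M[F]_d) (A24 : 'M[F]_(d, u)) :
  strangeness_free (canE F 0 d a u z) (canA a z (A12 : 'M[F]_(0, d)) A14 A22 A24).
Proof.
suff : strangeness_free (block_mx 1%:M 0 0 0 : 'M[F]_(d + (a + z), d + (a + u)))
    (block_mx A22 (row_mx 0 A24) 0 (block_mx 1%:M 0 0 0)).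
  by rewrite canE_nil canA_nil.
move=> w; rewrite -(hsubmxK w) -(hsubmxK (rsubmx w)).
move: (lsubmx w) (lsubmx (rsubmx w)) (rsubmx (rsubmx w)).
move=> w1 w2 w3; rewrite !mul_row_block !mulmx0 !mulmx1 !addr0.
move=> /row_mx0P[-> _]; rewrite !mul0mx !add0r => w0.
suff -> : w2 = 0 by rewrite !row_mx0.
apply/rowP => j.
have := w0 (col_mx 0 (col_mx (delta_mx j 0) 0)).
rewrite !mul_block_col !mul_row_col !mul0mx !mulmx0 !addr0 col_mx0 => /(_ erefl).
by rewrite add0r -colE => /matrixP/(_ 0 0); rewrite !mxE.
Qed.

(** E is normalized first and then the block A22 of A that maps the kernel of E to
    its cokernel. The hypothesis says that the block left of A22 vanishes in the zero
    rows of the normalized A22, so column operations with the identity clear it; row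
    operations clear the block above the identity. Neither changes E. *)
Lemma strangeness_free_canonical_form l k (E A : 'M[F]_(l, k)) :
  strangeness_free E A ->
  exists d a u z (A12 : 'M[F]_(0, d)) (A14 : 'M[F]_(0, u)) (A22 : 'M[F]_d)
    (A24 : 'M[F]_(d, u)),
    pair_equiv E A (canE F 0 d a u z) (canA a z A12 A14 A22 A24).
Proof.
move=> free0.
have [l2 [k2 [P [Q [nP nQ EQ]]]]] := rank_normal_form E.
move: (\rank E) P Q nP nQ EQ => d P Q nP nQ EQ.
have eq1 : pair_equiv E A (block_mx 1%:M 0 0 0) (P *m A *m Q) by exists P, Q.
move: (P *m A *m Q) eq1 => A1; rewrite -(submxK A1).
move: (ulsubmx A1) (ursubmx A1) (dlsubmx A1) (drsubmx A1) => A11 A12 A21 A22 eq1.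
have [z [u [P2 [Q2 [nP2 nQ2 EQ2]]]]] := rank_normal_form A22.
move: (\rank A22) P2 Q2 nP2 nQ2 EQ2 => a P2 Q2 nP2 nQ2 EQ2.
have {eq1 EQ2} eq2 : pair_equiv E A (block_mx 1%:M 0 0 0)
    (block_mx A11 (A12 *m Q2) (P2 *m A21) (block_mx 1%:M 0 0 0)).
  apply: pair_equiv_trans eq1 _.
  exists (block_mx 1%:M 0 0 P2), (block_mx 1%:M 0 0 Q2).
  rewrite !nonsingular_upper ?nonsingular1 // !mulmx_block.
  by rewrite !mx_simp EQ2; split.
move: (P2 *m A21) (A12 *m Q2) eq2 => X Y.
rewrite -(vsubmxK X) -(hsubmxK Y); move: (usubmx X) (dsubmx X) (lsubmx Y) (rsubmx Y).
move=> X1 X2 Y1 Y2 eq2.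
(* The rows of X2 are w A for w in the left kernel of both E and A22. *)
have X20 : X2 = 0.
  apply/row_matrixP => i; rewrite row0 rowE.
  have := strangeness_free_equiv eq2 free0 (w := row_mx 0 (row_mx 0 (delta_mx 0 i))).
  rewrite !mul_row_block !mul_row_col !mx_simp !row_mx0 => /(_ erefl).
  move=> h; apply: (proj1 (row_mx0P (h _))) => x.
  rewrite -(vsubmxK x) mul_block_col mul_row_col !mx_simp => /col_mx0P[-> _].
  by rewrite mulmx0.
exists d, a, u, z, 0, 0, (A11 - Y1 *m X1), Y2.
suff : pair_equiv E A (block_mx 1%:M 0 0 0 : 'M[F]_(d + (a + z), d + (a + u)))
    (block_mx (A11 - Y1 *m X1) (row_mx 0 Y2) 0 (block_mx 1%:M 0 0 0)).
  by rewrite canE_nil canA_nil.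
apply: pair_equiv_trans eq2 _; rewrite X20.
exists (block_mx 1%:M (row_mx (- Y1) 0) 0 1%:M), (block_mx 1%:M 0 (col_mx (- X1) 0) 1%:M).
rewrite nonsingular_upper ?nonsingular_lower ?nonsingular1 //; split=> //.
  by rewrite !mulmx_block !mx_simp.
rewrite !mulmx_block !mx_simp mul_row_col mul_row_block !mx_simp add_row_mx subrr.
rewrite mul_row_col mul_block_col !mx_simp add_col_mx.
by rewrite subrr addr0 mulNmx col_mx0.
Qed.

Lemma iterated_strangeness0 l k (E A : 'M[F]_(l, k)) :
  iterated_strangeness E A 0 0 <-> strangeness_free E A.
Proof.
split=> [|/strangeness_free_canonical_form]; last first.
  move=> [d [a [u [z [A12 [A14 [A22 [A24 h]]]]]]]].
  exact: strangeness_here h.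
suff aux i s : iterated_strangeness E A i s -> i = 0%N -> s = 0%N -> strangeness_free E A.
  by move=> /aux; apply.
case=> // {l k E A s} l k E A s d a u z A12 A14 A22 A24 h _ s0.
subst s; move/pair_equiv_sym: h => h.
by apply: strangeness_free_equiv h _; apply: strangeness_free_canon.
Qed.

(** After a reduction step, x_1 has become algebraic and is fixed by the fourth
    block row; the first block row then has to fix algebraic unknowns by itself,
    which it does when A14 has independent rows. *)
Lemma strangeness_free_reduced s d a u z A12 A14 A22 A24 :
  row_free A14 ->
  strangeness_free (canE_reduced F s d a u z)
    (canA a z (A12 : 'M[F]_(s, d)) A14 A22 A24).
Proof.
move=> free14 w.
rewrite -(hsubmxK w) -(hsubmxK (rsubmx w)) -(hsubmxK (rsubmx (rsubmx w))).
rewrite -(hsubmxK (rsubmx (rsubmx (rsubmx w)))).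
move: (lsubmx w) (lsubmx (rsubmx w)) (lsubmx (rsubmx (rsubmx w))).
move: (lsubmx (rsubmx (rsubmx (rsubmx w)))) (rsubmx (rsubmx (rsubmx (rsubmx w)))).
move=> {w} w4 w5 w1 w2 w3.
rewrite /canE_reduced !mul_row_block !mx_simp => /row_mx0P[_ /row_mx0P[-> _]].
rewrite /canA !mul_row_col !mx_simp !mul_mx_row !mx_simp.
do ?rewrite add_row_mx !mx_simp.
move=> h.
have kill (x1 : 'cV[F]_s) (x3 : 'cV[F]_a) (x4 : 'cV[F]_u) :
  w4 *m x1 + (w3 *m x3 + w1 *m A14 *m x4) = 0.
  have := h (col_mx x1 (col_mx 0 (col_mx x3 x4))).
  rewrite !mul_block_col !mx_simp !col_mx0.
  by move=> /(_ erefl); rewrite !mul_row_col !mx_simp.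
have w40 : w4 = 0.
  apply/rowP => j; have := kill (delta_mx j 0) 0 0.
  by rewrite !mx_simp -colE => /matrixP/(_ 0 0); rewrite !mxE.
have w30 : w3 = 0.
  apply/rowP => j; have := kill 0 (delta_mx j 0) 0.
  by rewrite !mx_simp -colE => /matrixP/(_ 0 0); rewrite !mxE.
have w10 : w1 = 0.
  apply/(row_free_inj free14)/rowP => j; rewrite mul0mx.
  have := kill 0 0 (delta_mx j 0).
  by rewrite !mx_simp -colE => /matrixP/(_ 0 0); rewrite !mxE.
by rewrite w10 w30 w40 !mul0mx !row_mx0.
Qed.

End Pencils.

(** * The linear Navier-Stokes pencil *)
Section Reassociation.
Variables (F : fieldType) (b d m z : nat).

Let e := (esym (addnA b d (b + z)%N), esym (addnA b d m)).

Lemma canE_reassoc :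
  castmx e (block_mx (1%:M : 'M[F]_(b + d)) 0 0 (0 : 'M[F]_(b + z, m))) =
  canE F b d 0 m z.
Proof.
rewrite scalar_mx_block -(col_mx0 F b d m) -(row_mx0 F (b + z) b d) -block_mxA.
rewrite /canE; congr block_mx; rewrite ?row_mx0 ?col_mx0 //.
Qed.

Lemma canA_reassoc (W : 'M[F]_(b + d, d)) (S : 'M[F]_(b + d, m)) :
  castmx e (block_mx (row_mx 0 W) S (block_mx 1%:M 0 0 0 : 'M[F]_(b + z, b + d)) 0) =
  canA 0 z (usubmx W) (usubmx S) (dsubmx W) (dsubmx S).
Proof.
have -> : row_mx 0 W = block_mx 0 (usubmx W) 0 (dsubmx W) :> 'M[F]_(b + d, b + d).
  by rewrite block_mxEh col_mx0 vsubmxK.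
have -> : block_mx 1%:M 0 0 0 = row_mx (col_mx 1%:M 0) 0 :> 'M[F]_(b + z, b + d).
  by rewrite block_mxEh col_mx0.
rewrite -{1}(vsubmxK S) /e -block_mxA /canA !row_mx_nil.
rewrite [LHS]/block_mx; congr col_mx.
transitivity (col_mx (row_mx 0 (row_mx (dsubmx W) (dsubmx S)))
    (col_mx (row_mx 1%:M 0) 0 : 'M[F]_(b + z, b + (d + m)))).
  2: by congr col_mx; rewrite col_mx_nil.
rewrite [X in row_mx _ X]/block_mx -[LHS]block_mxEh [LHS]/block_mx; congr col_mx.
by rewrite row_mx0 -(col_mx0 F b z (d + m)%N) -block_mxEh /block_mx row_mx0.
Qed.

End Reassociation.

Section PositiveDefinite.
Variables (R : realFieldType) (n : nat) (M : 'M[R]_n).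
Hypothesis Msym : M^T = M.
Hypothesis Mpos : forall v : 'cV[R]_n, v != 0 -> 0 < (v^T *m M *m v) 0 0.

Lemma posdef_eq0 (x : 'cV[R]_n) : x^T *m M *m x = 0 -> x = 0.
Proof.
by move=> x0; apply/eqP/negP => /negP/Mpos; rewrite x0 mxE ltxx.
Qed.

Lemma posdef_unit : M \in unitmx.
Proof.
rewrite -row_free_unit -kermx_eq0; apply/eqP/row_matrixP => i; rewrite row0.
have rM : row i (kermx M) *m M = 0 by rewrite -row_mul mulmx_ker row0.
apply: trmx_inj; rewrite trmx0; apply: posdef_eq0.
by rewrite trmxK rM mul0mx.
Qed.

(** If c B M^-1 B^T = 0 then c B M^-1 (c B)^T = 0, and M^-1 is positive definite
    along with M. *)
Lemma schur_ker k m (C : 'M[R]_(k, m)) (B : 'M[R]_(m, n)) :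
  C *m (B *m invmx M *m B^T) = 0 -> C *m B = 0.
Proof.
move=> h; apply/row_matrixP => i; rewrite row0 row_mul.
have {h} : row i C *m (B *m invmx M *m B^T) = 0 by rewrite -row_mul h row0.
move: (row i C) => c h; apply: trmx_inj; rewrite trmx0.
rewrite -[LHS](mulKVmx posdef_unit).
rewrite [X in _ *m X](posdef_eq0 (x := invmx M *m (c *m B)^T)) ?mulmx0 //.
rewrite trmx_mul trmxK trmx_inv Msym -!mulmxA mulKVmx ?posdef_unit //.
by move: h; rewrite trmx_mul !mulmxA => ->; rewrite mul0mx.
Qed.

Lemma schur_unit m (B : 'M[R]_(m, n)) :
  \rank B = m -> B *m invmx M *m B^T \in unitmx.
Proof.
move=> rB; rewrite -row_free_unit -kermx_eq0; apply/eqP.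
have /row_free_inj : row_free B by rewrite /row_free rB.
by apply; rewrite mul0mx; apply: schur_ker; rewrite mulmx_ker.
Qed.

(** The rows of B are w A for w in the left kernel of E, and they vanish on the
    kernel of E, which consists of the vectors (0, p). *)
Lemma ns_pencil_not_strangeness_free m (K : 'M[R]_n) (C : 'M[R]_(n, m))
    (B : 'M[R]_(m, n)) :
  B != 0 -> ~ strangeness_free (block_mx M 0 0 0) (block_mx K C B 0).
Proof.
move=> B0 free; case/eqP: B0; apply/row_matrixP => i; rewrite row0 rowE.
have := free (row_mx 0 (delta_mx 0 i)).
rewrite !mul_row_block !mx_simp row_mx0 => /(_ erefl) h.
apply: (proj1 (row_mx0P (h _))) => x.
rewrite -(vsubmxK x) mul_block_col mul_row_col !mx_simp => /col_mx0P[Mx _].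
by rewrite -[usubmx x](mulKmx posdef_unit) Mx !mulmx0.
Qed.

(** With P B V = [I_b 0; 0 0], the velocities are transformed by V and the momentum
    equation by V^-1 M^-1; a multiple of the constraint is added to clear the first
    b columns of V^-1 M^-1 K V. This is the canonical form with s = b and a = 0, and
    its block A14 consists of the first b rows of V^-1 M^-1 B^T. *)
Lemma ns_pencil_canonical_form m (K : 'M[R]_n) (B : 'M[R]_(m, n)) :
  exists s d a u z (A12 : 'M[R]_(s, d)) (A14 : 'M[R]_(s, u)) (A22 : 'M[R]_d)
    (A24 : 'M[R]_(d, u)),
    pair_equiv (block_mx M 0 0 0) (block_mx (- K) B^T B 0)
      (canE R s d a u z) (canA a z A12 A14 A22 A24) /\ row_free A14.
Proof.
have [z [d [P [V [nP nV PBV]]]]] := rank_normal_form B.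
move: (\rank B) P V nP nV PBV => b P V nP nV PBV.
have /nonsingularP[Vi [VVi ViV]] := nV.
pose W := Vi *m invmx M *m K *m V.
pose S := Vi *m invmx M *m B^T.
have uM := posdef_unit.
have nVi : nonsingular (Vi *m invmx M).
  apply: nonsingularM; last by apply: nonsingular_unitmx; rewrite unitmx_inv.
  by apply/nonsingularP; exists V.
have eq1 : pair_equiv (block_mx M 0 0 0) (block_mx (- K) B^T B 0)
    (block_mx (1%:M : 'M[R]_(b + d)) 0 0 (0 : 'M[R]_(b + z, m)))
    (block_mx (row_mx 0 (- rsubmx W)) S (block_mx 1%:M 0 0 0) 0).
  exists (block_mx (Vi *m invmx M) (row_mx (lsubmx W) 0 *m P) 0 P).
  exists (block_mx V 0 0 1%:M).
  rewrite !mulmx_block !mx_simp mulmxKV // ViV; split=> //.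
  - exact: nonsingular_upper.
  - by apply: nonsingular_upper; rewrite ?nonsingular1.
  rewrite mulmxDl PBV -!mulmxA [P *m (B *m V)]mulmxA PBV.
  have -> : Vi *m (invmx M *m (- K *m V)) = - W by rewrite mulNmx !mulmxN !mulmxA.
  rewrite mulmxA -/S mul_row_block !mx_simp.
  by rewrite -[- W]hsubmxK add_row_mx !raddfN addNr addr0.
exists b, d, 0%N, m, z, (- usubmx (rsubmx W)), (usubmx S), (- dsubmx (rsubmx W)), (dsubmx S).
split.
  apply: pair_equiv_trans eq1 _.
  rewrite -!raddfN -canE_reassoc -canA_reassoc.
  exact: pair_equiv_cast.
(* A left null vector w of A14 yields c = [w 0] P with c B M^-1 B^T = 0. *)
rewrite -kermx_eq0; apply/eqP.
set w := kermx _; have wS : row_mx w (0 : 'M[R]_(b, d)) *m S = 0.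
  by rewrite -[S]vsubmxK mul_row_col mulmx_ker mul0mx addr0.
have cB : row_mx w 0 *m P *m B = row_mx w 0 *m Vi.
  rewrite -[B]mulmx1 -VVi !mulmxA -[_ *m P *m B]mulmxA -[_ *m (P *m B) *m V]mulmxA.
  by rewrite PBV mul_row_block !mx_simp.
have : row_mx w 0 *m P *m B = 0.
  apply: schur_ker; rewrite !mulmxA cB; move: wS; rewrite /S !mulmxA; exact.
rewrite cB => /(congr1 (mulmx^~ V)); rewrite -mulmxA ViV mulmx1 mul0mx.
by case/row_mx0P.
Qed.

Lemma ns_pencil_index m (K : 'M[R]_n) (B : 'M[R]_(m, n)) :
  B != 0 ->
  pair_strangeness_index (block_mx M 0 0 0) (block_mx (- K) B^T B 0) 1.
Proof.
move=> B0; split; last first.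
  by case=> // _ /iterated_strangeness0; apply: ns_pencil_not_strangeness_free.
have [s [d [a [u [z [A12 [A14 [A22 [A24 [h free14]]]]]]]]]] :=
  ns_pencil_canonical_form K B.
apply: strangeness_step h _.
by apply/iterated_strangeness0; apply: strangeness_free_reduced.
Qed.

End PositiveDefinite.

(** * Smooth maps *)
Section SmoothCalculus.
Variable R : realType.
Implicit Types U V W : normedModType R.

(** Holds for finite-dimensional V; it lets plain linear functions be
    differentiated without packaging them as continuous linear maps. *)
Definition linear_maps_continuous V : Prop :=
  forall W (L : V -> W), linear L -> continuous L.

Lemma linear_mx_sum m n W (L : 'M[R]_(m, n) -> W) : linear L ->
  forall A, L A = \sum_i \sum_j A i j *: L (delta_mx i j).
Proof.
move=> linL A; pose LL : {linear 'M[R]_(m, n) -> W} :=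
  HB.pack L (GRing.isLinear.Build _ _ _ _ L linL).
rewrite -[L]/(LL : _ -> _) {1}[A]matrix_sum_delta linear_sum; apply: eq_bigr => i _.
by rewrite linear_sum; apply: eq_bigr => j _; rewrite linearZ.
Qed.

Lemma continuous_sum_fun U W (I : Type) (r : seq I) (F : I -> U -> W) :
  (forall i, continuous (F i)) -> continuous (fun x => \sum_(i <- r) F i x).
Proof.
move=> cF; elim: r => [|i r IH].
  by under eq_fun do rewrite big_nil; move=> x; apply: cvg_cst.
by under eq_fun do rewrite big_cons; move=> x; apply: cvgD; [apply: cF|apply: IH].
Qed.

Lemma mx_linear_maps_continuous m n : linear_maps_continuous 'M[R]_(m, n).
Proof.
move=> W L linL.
rewrite (_ : L = fun A => \sum_i \sum_j A i j *: L (delta_mx i j)); last first.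
  by apply/funext => A; apply: linear_mx_sum.
apply: continuous_sum_fun => i; apply: continuous_sum_fun => j A.
apply: (@continuousZr_tmp _ _ _ (fun A : 'M[R]_(m, n) => A i j)).
exact: coord_continuous.
Qed.

Lemma scalar_linear_maps_continuous : linear_maps_continuous R.
Proof.
move=> W L linL; pose LL : {linear R -> W} :=
  HB.pack L (GRing.isLinear.Build _ _ _ _ L linL).
rewrite (_ : L = fun t => t *: L 1); last first.
  by apply/funext => t; rewrite -[L]/(LL : _ -> _) -linearZ /= [_ *: _]mulr1.
exact: scalel_continuous.
Qed.

Lemma pair_linear_maps_continuous U V :
  linear_maps_continuous U -> linear_maps_continuous V ->
  linear_maps_continuous (U * V)%type.
Proof.
move=> cU cV W L linL; pose LL : {linear (U * V)%type -> W} :=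
  HB.pack L (GRing.isLinear.Build _ _ _ _ L linL).
rewrite (_ : L = fun z => L (z.1, 0) + L (0, z.2)); last first.
  apply/funext => z; rewrite -[L]/(LL : _ -> _) -linearD; congr (LL _).
  by rewrite [LHS]surjective_pairing; congr pair; rewrite /= ?addr0 ?add0r.
have linU : linear (fun u : U => L (u, 0)).
  move=> a u u'; rewrite -linL; congr L; congr pair.
  by rewrite /= scaler0 addr0.
have linV : linear (fun v : V => L (0, v)).
  move=> a u u'; rewrite -linL; congr L; congr pair.
  by rewrite /= scaler0 addr0.
move=> z; apply: cvgD.
  apply: (@continuous_comp _ _ _ fst (fun u => L (u, 0))); first exact: cvg_fst.
  exact: (cU _ _ linU).
apply: (@continuous_comp _ _ _ snd (fun v => L (0, v))); first exact: cvg_snd.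
exact: (cV _ _ linV).
Qed.

Lemma is_diff_linear V W (L : V -> W) x :
  linear_maps_continuous V -> linear L -> is_diff x L L.
Proof.
move=> cV linL; pose LL : {linear V -> W} :=
  HB.pack L (GRing.isLinear.Build _ _ _ _ L linL).
have cL : continuous LL by apply: cV.
by apply: DiffDef; [exact: (@linear_differentiable _ _ _ LL)|exact: (@diff_lin _ _ _ LL)].
Qed.

Lemma is_diff_linear_post U V W (L : V -> W) (h dh : U -> V) x :
  linear_maps_continuous V -> linear L -> is_diff x h dh ->
  is_diff x (fun z => L (h z)) (fun k => L (dh k)).
Proof.
move=> cV linL hdh; have dL := is_diff_linear (h x) cV linL.
by have := is_diff_comp hdh dL.
Qed.

Lemma is_diff_linear_pre U V W (L : U -> V) (h : V -> W) x :
  linear_maps_continuous U -> linear L -> differentiable h (L x) ->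
  is_diff x (fun z => h (L z)) (fun k => 'd h (L x) (L k)).
Proof.
move=> cU linL dh; have dL := is_diff_linear x cU linL.
by have := is_diff_comp dL (differentiableP dh).
Qed.

Lemma is_diff_scale_fun U W (a : U -> R) (h : U -> W) x :
  differentiable a x -> differentiable h x ->
  is_diff x (fun z => a z *: h z) (fun k => 'd a x k *: h x + a x *: 'd h x k).
Proof.
have bilS : bilinear_for (GRing.Scale.Law.clone _ _ *:%R _)
    (GRing.Scale.Law.clone _ _ *:%R _) (@GRing.scale R W).
  split=> [u'|u] b y z /=; first by rewrite scalerDl scalerA.
  by rewrite scalerDr !scalerA mulrC.
pose S : {bilinear R -> W -> W} :=
  HB.pack (@GRing.scale R W) (bilinear_isBilinear.Build R R W W _ _ _ bilS).
have cS : continuous (fun p : R * W => S p.1 p.2) by move=> p; apply: scale_continuous.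
move=> da dh.
have dS : is_diff (a x, h x) (fun p : R * W => S p.1 p.2)
    (fun q => S (a x) q.2 + S q.1 (h x)).
  by apply: DiffDef; [exact: differentiable_bilin|rewrite diff_bilin].
have dp := is_diff_pair (differentiableP da) (differentiableP dh).
have := is_diff_comp dp dS.
case=> dd ee; apply: DiffDef; first exact: dd.
by apply: (etrans ee); apply/funext => k /=; rewrite addrC.
Qed.


Lemma is_diff_add U W (a h da dh : U -> W) x :
  is_diff x a da -> is_diff x h dh ->
  is_diff x (fun z => a z + h z) (fun k => da k + dh k).
Proof. exact: is_diffD. Qed.

Definition smooth V W (h : V -> W) : Prop := smooth_on setT h.

Lemma smoothP V W (h : V -> W) :
  smooth h <->
  (forall x, differentiable h x) /\ (forall k, smooth (fun x => 'd h x k)).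
Proof.
split=> [sm|[dh sm] [|k]] /=.
- split=> [x|k i]; first exact: (sm 1%N).1.
  by have [_] := sm i.+1; apply.
- by move=> x _; apply: differentiable_continuous.
- by split=> [x _|v]; [apply: dh|apply: sm].
Qed.

Lemma smooth_differentiable V W (h : V -> W) x : smooth h -> differentiable h x.
Proof. by move=> /smoothP[]. Qed.

Lemma smooth_diff V W (h : V -> W) k : smooth h -> smooth (fun x => 'd h x k).
Proof. by move=> /smoothP[]. Qed.

(** Smoothness is the largest predicate on maps that implies differentiability
    and passes to all partial differentials. *)
Lemma smooth_coind V W (P : (V -> W) -> Prop) :
  (forall h, P h ->
    exists dh : V -> V -> W, (forall x, is_diff x h (dh x)) /\
    forall k, P (fun x => dh x k)) ->
  forall h, P h -> smooth h.
Proof.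
move=> cl h Ph k; elim: k h Ph => [|k IH] h /cl[dh [hdh Pdh]] /=.
  by move=> x _; apply: differentiable_continuous; case: (hdh x).
split=> [x _|v]; first by case: (hdh x).
rewrite (_ : (fun x => 'd h x v) = (fun x => dh x v)); first exact: IH.
by apply/funext => x; case: (hdh x) => _ ->.
Qed.

Lemma smooth_cst V W (c : W) : smooth (fun _ : V => c).
Proof.
apply: (@smooth_coind V W (fun h => exists c, h = fun=> c)); last by exists c.
move=> _ [c' ->]; exists (fun _ _ => 0); split=> [x|k]; last by exists 0.
exact: is_diff_cst.
Qed.

Lemma smooth_linear V W (L : V -> W) :
  linear_maps_continuous V -> linear L -> smooth L.
Proof.
move=> cV linL; apply/smoothP; split=> [x|k].
  by case: (is_diff_linear x cV linL).
rewrite (_ : (fun x => _) = fun=> L k); first exact: smooth_cst.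
by apply/funext => x; case: (is_diff_linear x cV linL) => _ ->.
Qed.

Lemma smooth_linear_post U V W (L : V -> W) (h : U -> V) :
  linear_maps_continuous V -> linear L -> smooth h -> smooth (fun z => L (h z)).
Proof.
move=> cV linL smh.
apply: (@smooth_coind _ _ (fun F => exists2 h, smooth h & F = fun z => L (h z)));
  last by exists h.
move=> _ {h smh} [h smh ->]; exists (fun x k => L ('d h x k)); split=> [x|k].
  exact/is_diff_linear_post/differentiableP/smooth_differentiable.
by exists (fun x => 'd h x k) => //; apply: smooth_diff.
Qed.

Lemma smooth_linear_pre U V W (L : U -> V) (h : V -> W) :
  linear_maps_continuous U -> linear L -> smooth h -> smooth (fun z => h (L z)).
Proof.
move=> cU linL smh.
apply: (@smooth_coind _ _ (fun F => exists2 h, smooth h & F = fun z => h (L z)));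
  last by exists h.
move=> _ {h smh} [h smh ->]; exists (fun x k => 'd h (L x) (L k)); split=> [x|k].
  exact/is_diff_linear_pre/smooth_differentiable.
by exists (fun x => 'd h x (L k)) => //; apply: smooth_diff.
Qed.

Lemma smooth_add V W (a b : V -> W) :
  smooth a -> smooth b -> smooth (fun z => a z + b z).
Proof.
move=> sa sb.
apply: (@smooth_coind _ _ (fun F => exists a b,
  [/\ smooth a, smooth b & F = fun z => a z + b z])); last by exists a, b.
move=> _ {a b sa sb} [a [b [sa sb ->]]].
exists (fun x k => 'd a x k + 'd b x k); split=> [x|k].
  by apply: is_diff_add; apply/differentiableP/smooth_differentiable.
exists (fun x => 'd a x k), (fun x => 'd b x k).
by split=> //; apply: smooth_diff.
Qed.

Lemma smooth_sum V W (I : Type) (r : seq I) (a : I -> V -> W) :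
  (forall i, smooth (a i)) -> smooth (fun z => \sum_(i <- r) a i z).
Proof.
move=> sa; elim: r => [|i r IH].
  by under eq_fun do rewrite big_nil; apply: smooth_cst.
by under eq_fun do rewrite big_cons; apply: smooth_add.
Qed.

(** The differentials of a product are sums of two products; hence the invariant
    is closed under sums. *)
Lemma smooth_scale V W (a : V -> R) (b : V -> W) :
  smooth a -> smooth b -> smooth (fun z => a z *: b z).
Proof.
move=> sa sb.
pose P (F : V -> W) := exists (r : seq ((V -> R) * (V -> W))),
  (forall q, q \in r -> smooth q.1 /\ smooth q.2) /\
  F = fun z => \sum_(q <- r) q.1 z *: q.2 z.
apply: (@smooth_coind _ _ P); last first.
  exists [:: (a, b)]; split; first by move=> q; rewrite inE => /eqP->.
  by apply/funext => z; rewrite big_seq1.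
move=> _ [r [sr ->]]; elim: r sr => [|[q1 q2] r IH] sr.
  exists (fun _ _ => 0); split=> [x|k]; first last.
    by exists [::]; split=> //; apply/funext => z; rewrite big_nil.
  by under eq_fun do rewrite big_nil; apply: is_diff_cst.
have [|dh [hdh Pdh]] := IH.
  by move=> q qr; apply: sr; rewrite inE qr orbT.
have [s1 s2] : smooth q1 /\ smooth q2 by apply: (sr (q1, q2)); rewrite mem_head.
exists (fun x k => ('d q1 x k *: q2 x + q1 x *: 'd q2 x k) + dh x k); split=> [x|k].
  under eq_fun do rewrite big_cons.
  by apply: is_diff_add => //; apply: is_diff_scale_fun; apply: smooth_differentiable.
have [r' [sr' er']] := Pdh k.
exists [:: (fun x => 'd q1 x k, q2), (q1, fun x => 'd q2 x k) & r']; split.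
  move=> q; rewrite !inE => /or3P[/eqP->|/eqP->|/sr'//] /=;
    by split=> //; apply: smooth_diff.
by apply/funext => z; rewrite !big_cons (congr1 (@^~ z) er') addrA.
Qed.

(** Applying the differential to a point-dependent vector keeps smoothness: it is
    the sum of the partial differentials weighted by the coordinates. *)
Lemma smooth_diff_apply U m n W (L w : U -> 'M[R]_(m, n)) (h : 'M[R]_(m, n) -> W) :
  linear_maps_continuous U -> linear L -> smooth w -> smooth h ->
  smooth (fun z => 'd h (L z) (w z)).
Proof.
move=> cU linL sw sh.
rewrite (_ : (fun z => _) = fun z =>
    \sum_i \sum_j w z i j *: 'd h (L z) (delta_mx i j)); last first.
  by apply/funext => z; apply: linear_mx_sum => a u v; rewrite linearP.
apply: smooth_sum => i; apply: smooth_sum => j; apply: smooth_scale.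
  apply: (@smooth_linear_post _ _ _ (fun A : 'M[R]_(m, n) => A i j)) => //.
    exact: mx_linear_maps_continuous.
  by move=> a u v; rewrite !mxE.
by apply: (smooth_linear_pre (h := fun v => 'd h v (delta_mx i j))) => //;
  apply: smooth_diff.
Qed.

End SmoothCalculus.

(** * Total derivatives of the DAE *)
Section TotalDerivatives.
Variables (R : realType) (n m : nat).
Variables (M : 'M[R]_n) (K : 'cV[R]_n -> 'cV[R]_n) (B : 'M[R]_(m, n)).
Variables (f : R -> 'cV[R]_n) (g : R -> 'cV[R]_m).
Hypothesis Ksmooth : smooth K.
Hypothesis fsmooth : smooth f.
Hypothesis gsmooth : smooth g.

Definition time_derivative (V : normedModType R) (i : nat) (h : R -> V) : R -> V :=
  iter i (fun (h : R -> V) (t : R) => 'd h t 1) h.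

Lemma smooth_time_derivative (V : normedModType R) i (h : R -> V) :
  smooth h -> smooth (time_derivative i h).
Proof. by move=> sh; elim: i => //= i; apply: smooth_diff. Qed.

(** The i-th total time derivative of K(v), as a function of the rows
    v, v', ..., v^(i). *)
Fixpoint convection (i : nat) : 'M[R]_(i.+1, n) -> 'cV[R]_n :=
  match i with
  | 0 => fun V => K (row ord0 V)^T
  | i'.+1 => fun V => 'd (convection (i := i')) (row' ord_max V) (row' ord0 V)
  end.

Lemma smooth_convection i : smooth (convection (i := i)).
Proof.
elim: i => [|i IH] /=.
  apply: (smooth_linear_pre (L := fun V : 'M[R]_(1, n) => (row ord0 V)^T)) => //.
    exact: mx_linear_maps_continuous.
  by move=> a u v; rewrite !linearP.
apply: smooth_diff_apply => //.
- exact: mx_linear_maps_continuous.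
- by move=> a u v; apply/matrixP => k l; rewrite !mxE.
- apply: smooth_linear; first exact: mx_linear_maps_continuous.
  by move=> a u v; apply/matrixP => k l; rewrite !mxE.
Qed.

Local Notation F := (ns_dae M K B f g).

(** The DAE is the sum of a map linear in (x, x'), of K(v) and of the
    inhomogeneities; this shape is preserved by total differentiation, because the
    highest derivative of v enters only through M. *)
Lemma total_derivativeE i (z : jet R (n + m) i.+2) :
  let y := row' ord_max z.2 in
  total_derivative F (i := i) z =
  col_mx (M *m usubmx (row ord_max z.2)^T + convection (lsubmx y)
          - B^T *m dsubmx (row ord_max y)^T - time_derivative i f z.1)
         (B *m usubmx (row ord_max y)^T - time_derivative i g z.1).
Proof.
elim: i z => [|i IH] z.
  rewrite /= /ns_dae /=; congr col_mx; congr (_ - _).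
    congr (_ + K _ - B^T *m _).
      by apply/colP => k; rewrite !mxE; congr (z.2 _ _); apply: val_inj.
    by apply/colP => k; rewrite !mxE; congr (z.2 _ _); apply: val_inj.
  congr (B *m _).
  by apply/colP => k; rewrite !mxE; congr (z.2 _ _); apply: val_inj.
pose Y (z : jet R (n + m) i.+2) := row' ord_max z.2.
pose Lin (z : jet R (n + m) i.+2) :=
  col_mx (M *m usubmx (row ord_max z.2)^T - B^T *m dsubmx (row ord_max (Y z))^T)
         (B *m usubmx (row ord_max (Y z))^T).
have eqF : total_derivative F (i := i) = fun z => Lin z +
    (col_mx (convection (lsubmx (Y z))) 0 +
    (col_mx (- time_derivative i f z.1) 0 + col_mx 0 (- time_derivative i g z.1))).
  apply/funext => w; rewrite IH !add_col_mx !add0r !addr0; congr col_mx.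
  by rewrite addrA; congr (_ - _); rewrite addrAC.
have cJ : linear_maps_continuous (jet R (n + m) i.+2).
  apply: pair_linear_maps_continuous; first exact: scalar_linear_maps_continuous.
  exact: mx_linear_maps_continuous.
have linY : linear Y by move=> a u v; rewrite /Y linearP.
have linLin : linear Lin.
  move=> a u v; rewrite /Lin linY !linearP /= scale_col_mx add_col_mx; congr col_mx.
  by rewrite scalerBr scalerN addrACA.
pose a : jet R (n + m) i.+2 := (z.1, row' ord_max z.2).
have D1 := is_diff_linear a cJ linLin.
have cN k : linear_maps_continuous 'cV[R]_k by exact: mx_linear_maps_continuous.
have linup : linear (fun u : 'cV[R]_n => col_mx u 0 : 'cV[R]_(n + m)).
  by move=> c u v; rewrite scale_col_mx add_col_mx scaler0 addr0.
have lindn : linear (fun u : 'cV[R]_m => col_mx 0 u : 'cV[R]_(n + m)).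
  by move=> c u v; rewrite scale_col_mx add_col_mx scaler0 addr0.
have linopp k : linear (fun u : 'cV[R]_k => - u) by move=> c u v; rewrite linearP.
have lin1 : linear (fst : jet R (n + m) i.+2 -> R) by [].
have linlY : linear (fun z => lsubmx (Y z) : 'M[R]_(i.+1, n)).
  by move=> c u v; rewrite linY linearP.
have D2 := is_diff_linear_post (cN _) linup
  (is_diff_linear_pre cJ linlY (smooth_differentiable (lsubmx (Y a)) (smooth_convection i))).
have D3 := is_diff_linear_post (cN _) linup (is_diff_linear_post (cN _) (linopp n)
  (is_diff_linear_pre cJ lin1 (smooth_differentiable a.1 (smooth_time_derivative i fsmooth)))).
have D4 := is_diff_linear_post (cN _) lindn (is_diff_linear_post (cN _) (linopp m)
  (is_diff_linear_pre cJ lin1 (smooth_differentiable a.1 (smooth_time_derivative i gsmooth)))).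
have [_ D] := is_diff_add D1 (is_diff_add D2 (is_diff_add D3 D4)).
cbv zeta; rewrite [LHS]/= eqF [LHS](congr1 (@^~ _) D).
rewrite !add_col_mx !add0r !addr0 /=.
have -> : row ord_max (row' ord0 z.2) = row ord_max z.2.
  by apply/matrixP => k l; rewrite !mxE; congr (z.2 _ _); apply: val_inj.
have -> : row ord_max (Y (1, row' ord0 z.2)) = row ord_max (row' ord_max z.2).
  apply/matrixP => k l; rewrite !mxE; congr (z.2 _ _); apply: val_inj.
  by rewrite /= /bump !ltnn.
have -> : lsubmx (Y a) = row' ord_max (lsubmx (row' ord_max z.2)).
  by apply/matrixP => k l; rewrite !mxE; congr (z.2 _ _); apply: val_inj.
have -> : lsubmx (Y (1, row' ord0 z.2)) = row' ord0 (lsubmx (row' ord_max z.2)).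
  apply/matrixP => k l; rewrite !mxE; congr (z.2 _ _); apply: val_inj.
  by rewrite /= /bump [(i.+1 <= k)%N]leqNgt ltn_ord [(i.+2 <= _)%N]ltnNge ltn_ord.
by congr col_mx; rewrite addrA; congr (_ - _); rewrite addrAC.
Qed.

End TotalDerivatives.

(** * Jacobians of the first derivative array *)
Section Jacobians.
Variable R : realType.

Lemma eq_mul_rV (p q : nat) (A B : 'M[R]_(p, q)) :
  (forall y : 'rV_p, y *m A = y *m B) -> A = B.
Proof. by move=> eqAB; apply/row_matrixP => i; rewrite !rowE eqAB. Qed.

Lemma row_row' k p (A : 'M[R]_(k.+1, p)) i0 (i : 'I_k) :
  row i (row' i0 A) = row (lift i0 i) A.
Proof. by apply/rowP => j; rewrite !mxE. Qed.

Lemma tr_row_lsubmx k p q (A : 'M[R]_(k, p + q)) i :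
  (row i (lsubmx A))^T = usubmx (row i A)^T.
Proof. by apply/colP => j; rewrite !mxE. Qed.

Lemma row_head k p (x : 'rV[R]_p) (Y : 'M[R]_(k, p)) (i : 'I_(1 + k)) :
  i = 0%N :> nat -> row i (col_mx x Y) = x.
Proof.
move=> i0; have -> : i = lshift k ord0 by apply: val_inj.
by rewrite rowKu row_id.
Qed.

Lemma row_tail k p (x : 'rV[R]_p) (Y : 'M[R]_(k, p)) (i : 'I_(1 + k)) (j : 'I_k) :
  i = j.+1 :> nat -> row i (col_mx x Y) = row j Y.
Proof. by move=> ij; have -> : i = rshift 1 j by [apply: val_inj]; rewrite rowKd. Qed.

(** The derivative arrays of order 0 and 1 are affine in (x', x''), so their
    Jacobians can be read off as differences. *)
Lemma jacobian_affine p q (G : 'rV[R]_p -> 'rV[R]_q) a y :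
  linear (fun y => G y - G 0) -> y *m jacobian G a = G y - G 0.
Proof.
move=> linG; rewrite mul_rV_lin1.
have cp : linear_maps_continuous 'rV[R]_p by exact: mx_linear_maps_continuous.
have [_ D] := is_diff_add (is_diff_linear a cp linG) (is_diff_cst (G 0) a).
have -> : G = fun y => G y - G 0 + cst (G 0) y by apply/funext => u; rewrite subrK.
by rewrite D [cst _ _]/= !subrK addr0.
Qed.

End Jacobians.

Section NavierStokesJacobians.
Variables (R : realType) (n m : nat).
Variables (M : 'M[R]_n) (K : 'cV[R]_n -> 'cV[R]_n) (B : 'M[R]_(m, n)).
Variables (f : R -> 'cV[R]_n) (g : R -> 'cV[R]_m).
Hypothesis Ksmooth : smooth K.
Hypothesis fsmooth : smooth f.
Hypothesis gsmooth : smooth g.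

Local Notation F := (ns_dae M K B f g).

Lemma ns_jac_xdot mu (z : jet R (n + m) mu.+2) :
  jac_xdot F z = block_mx M 0 0 0.
Proof.
apply: trmx_inj; rewrite trmxK; apply: eq_mul_rV => y.
have dF (x : 'cV[R]_(n + m)) (u : 'rV[R]_(n + m)) :
    (F z.1 x u^T)^T - (F z.1 x (0 : 'rV_(n + m))^T)^T = (block_mx M 0 0 0 *m u^T)^T.
  rewrite -raddfB /= /ns_dae -{2}[u^T]vsubmxK mul_block_col !mx_simp.
  rewrite opp_col_mx add_col_mx subrr trmx0 linear0 mulmx0 add0r.
  by rewrite -!(addrA (M *m _)) subrr addr0.
rewrite jacobian_affine ?dF -?trmx_mul ?trmxK //.
  by rewrite trmx_mul trmxK.
by move=> c u v; rewrite !dF !linearP.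
Qed.

Lemma convection0 (V : 'M[R]_(1, n)) : convection K V = K (row ord0 V)^T.
Proof. by []. Qed.

Lemma convection1 (V : 'M[R]_(2, n)) :
  convection K V = 'd K ((row ord0 V)^T) (row ord_max V)^T.
Proof.
rewrite /=.
have c1 : linear_maps_continuous 'M[R]_(1, n) by exact: mx_linear_maps_continuous.
have lin0 : linear (fun V : 'M[R]_(1, n) => (row ord0 V)^T).
  by move=> a u v; rewrite !linearP.
have [_ D] := is_diff_linear_pre (x := row' ord_max V) c1 lin0
  (smooth_differentiable _ Ksmooth).
rewrite [LHS](congr1 (@^~ _) D).
have -> : row ord0 (row' ord_max V) = row ord0 V.
  by apply/rowP => k; rewrite !mxE; congr (V _ _); apply: val_inj.
suff -> : row ord0 (row' ord0 V) = row ord_max V by [].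
by apply/rowP => k; rewrite !mxE; congr (V _ _); apply: val_inj.
Qed.

Lemma derivative_array1E t (x : 'rV[R]_(n + m)) (Y : 'M[R]_(2, n + m)) :
  let v := usubmx x^T in let p := dsubmx x^T in
  let v1 := usubmx (row ord0 Y)^T in let p1 := dsubmx (row ord0 Y)^T in
  let v2 := usubmx (row ord_max Y)^T in
  derivative_array F ((t, col_mx x Y) : jet R (n + m) 3) =
  col_mx (col_mx (M *m v1 + K v - B^T *m p - f t) (B *m v - g t))^T
         (col_mx (M *m v2 + 'd K v v1 - B^T *m p1 - 'd f t 1) (B *m v1 - 'd g t 1))^T
  :> 'M[R]_(1 + 1, n + m).
Proof.
cbv zeta.
apply/row_matrixP => i; apply: trmx_inj.
have [->|->] : i = @lshift 1 1 ord0 \/ i = @rshift 1 1 ord0.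
  by case: i => [[|[|i]] // ?]; [left|right]; apply: val_inj.
  rewrite rowKu row_id trmxK.
  rewrite [LHS](_ : _ = total_derivative F (i := 0) (t, col_mx x (row ord0 Y))).
    rewrite total_derivativeE // convection0 tr_row_lsubmx !row_row' [(_, _).2]/=.
    by rewrite (@row_tail R 1 _ _ _ _ ord0) // !(@row_head R 1) // row_id.
  rewrite rowK trmxK; congr (total_derivative F (_, _)).
  apply/row_matrixP => k; rewrite row_rowsub.
  case: k => [[|[|k]] // hk].
    by rewrite (@row_head R 2) ?inordK // (@row_head R 1).
  rewrite (@row_tail R 2 _ _ _ _ ord0) ?inordK //.
  by rewrite (@row_tail R 1 _ _ _ _ ord0) // row_id.
rewrite rowKd row_id trmxK.
rewrite [LHS](_ : _ = total_derivative F (i := 1) (t, col_mx x Y)).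
  rewrite total_derivativeE // convection1 !tr_row_lsubmx !row_row' [(_, _).2]/=.
  rewrite (@row_head R 2 _ _ _ (lift ord_max ord0)) //.
  rewrite (@row_tail R 2 _ _ _ ord_max ord_max) //.
  by rewrite (@row_tail R 2 _ _ _ (lift ord_max ord_max) ord0).
rewrite rowK trmxK; congr (total_derivative F (_, _)).
apply/row_matrixP => k; rewrite row_rowsub; congr row.
by apply: val_inj; rewrite /= inordK.
Qed.

End NavierStokesJacobians.

(** * Ranks *)
Section Ranks.
Variable F : fieldType.

Lemma mul_rV_lin1_linear p q (h : 'rV[F]_p -> 'rV[F]_q) u :
  linear h -> u *m lin1_mx h = h u.
Proof.
move=> linh; pose hh : {linear 'rV[F]_p -> 'rV[F]_q} :=
  HB.pack h (GRing.isLinear.Build _ _ _ _ h linh).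
exact: (mul_rV_lin1 hh).
Qed.

Lemma mxrank_surjective p q (A : 'M[F]_(p, q)) :
  (forall y : 'rV_q, exists x : 'rV_p, x *m A = y) -> \rank A = q.
Proof.
move=> surj; apply/eqP; rewrite -[_ == _]/(row_full A) -sub1mx.
apply/row_subP => i; have [x <-] := surj (row i 1%:M); exact: submxMl.
Qed.

Lemma mxrank_injective p q (A : 'M[F]_(p, q)) :
  (forall y : 'rV_p, y *m A = 0 -> y = 0) -> \rank A = p.
Proof.
move=> inj; apply/eqP; rewrite -[_ == _]/(row_free A) -kermx_eq0.
by apply/eqP/row_matrixP => i; rewrite row0; apply: inj; rewrite -row_mul mulmx_ker row0.
Qed.

Lemma mxrank_injective_tr p q (A : 'M[F]_(p, q)) :
  (forall y : 'cV_q, A *m y = 0 -> y = 0) -> \rank A = q.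
Proof.
move=> inj; rewrite -mxrank_tr; apply: mxrank_injective => y yA.
by apply: trmx_inj; rewrite trmx0; apply: inj; rewrite -[A]trmxK -trmx_mul yA trmx0.
Qed.

Lemma kernel_basis p q (A : 'M[F]_(q, p)) :
  \rank A = q ->
  exists T : 'M[F]_(p, p - q), A *m T = 0 /\ \rank T = (p - q)%N.
Proof.
move=> rA; have rk : \rank (kermx A^T) = (p - q)%N by rewrite mxrank_ker mxrank_tr rA.
rewrite -rk; exists (row_base (kermx A^T))^T; split; last first.
  by rewrite mxrank_tr; apply/eqP; apply: row_base_free.
apply: trmx_inj; rewrite trmx_mul trmxK trmx0.
by apply/sub_kermxP; rewrite eq_row_base.
Qed.

End Ranks.

(** * The strangeness hypothesis with mu = 1 *)
Section SecondArray.
Variables (R : realType) (n m : nat).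
Variables (M : 'M[R]_n) (K : 'cV[R]_n -> 'cV[R]_n) (B : 'M[R]_(m, n)).
Variables (f : R -> 'cV[R]_n) (g : R -> 'cV[R]_m).
Hypothesis Msym : M^T = M.
Hypothesis Mpos : forall v : 'cV[R]_n, v != 0 -> 0 < (v^T *m M *m v) 0 0.
Hypothesis Brank : \rank B = m.
Hypothesis Ksmooth : smooth K.
Hypothesis fsmooth : smooth f.
Hypothesis gsmooth : smooth g.

Local Notation F := (ns_dae M K B f g).
Local Notation N := (n + m)%N.
Local Notation S := (B *m invmx M *m B^T).

Let uM : M \in unitmx. Proof. exact: posdef_unit Mpos. Qed.
Let uS : S \in unitmx. Proof. exact: schur_unit. Qed.

(** Applied to the rows F and dF/dt of the derivative array, this returns the
    constraint B v - g and the combination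
    B M^-1 (M v' + K(v) - B^T p - f) - (B v' - g'), in which v' cancels. *)
Definition constraint_rows (A : 'M[R]_(1 + 1, N)) : 'M[R]_(1 + 1, m) :=
  col_mx (rsubmx (row ord0 A))
         (lsubmx (row ord0 A) *m (B *m invmx M)^T - rsubmx (row ord_max A)).

Lemma constraint_rows_linear : linear constraint_rows.
Proof.
move=> c u v; rewrite /constraint_rows !linearP /= scale_col_mx add_col_mx.
by rewrite mulmxDl -scalemxAl scalerBr scalerN addrACA.
Qed.

(** The matrix Z_2 of the strangeness hypothesis; it is constant. *)
Definition constraint_mx : 'M[R]_((1 + 1) * N, (1 + 1) * m) :=
  lin1_mx (fun u => mxvec (constraint_rows (vec_mx u))).

Lemma mul_constraint_mx A : mxvec A *m constraint_mx = mxvec (constraint_rows A).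
Proof.
rewrite mul_rV_lin1_linear ?mxvecK // => c u v.
by rewrite linearP constraint_rows_linear linearP.
Qed.

Lemma mxrank_constraint_mx : \rank constraint_mx = (2 * m)%N.
Proof.
apply: mxrank_surjective => y; rewrite -(vec_mxK y).
move: (vec_mx y) => {y} U.
exists (mxvec (col_mx (row_mx 0 (row ord0 U)) (row_mx 0 (- row ord_max U))
  : 'M[R]_(1 + 1, N))).
rewrite mul_constraint_mx; congr mxvec; rewrite /constraint_rows.
rewrite (@row_head R 1) // (@row_tail R 1 _ _ _ ord_max ord0) // row_id.
rewrite row_mxKr row_mxKl row_mxKr mul0mx sub0r opprK.
apply/row_matrixP => i; case: i => [[|[|i]] // hi].
  by rewrite (@row_head R 1) //; congr row; apply: val_inj.
rewrite (@row_tail R 1 _ _ _ _ ord0) // row_id; congr row; exact: val_inj.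
Qed.

(** The Jacobian matrix of K at v. *)
Definition convection_mx (v : 'cV[R]_n) : 'M[R]_n :=
  \sum_j 'd K v (delta_mx j 0) *m delta_mx 0 j.

Lemma mul_convection_mx v w : convection_mx v *m w = 'd K v w.
Proof.
rewrite [RHS](@linear_mx_sum R n 1 _ ('d K v)); last by move=> c a b; rewrite linearP.
rewrite mulmx_suml; apply: eq_bigr => j _.
rewrite big_ord1 -mulmxA -rowE [row j w](_ : _ = (w j 0)%:M) ?mul_mx_scalar //.
by apply/matrixP => a b; rewrite !ord1 !mxE eqxx mulr1n.
Qed.

Lemma smooth_convection_mx : smooth convection_mx.
Proof.
apply: smooth_sum => j.
apply: (smooth_linear_post (L := fun u : 'cV[R]_n => u *m (delta_mx 0 j : 'rV_n))
  (h := fun v => 'd K v (delta_mx j 0))).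
- exact: mx_linear_maps_continuous.
- by move=> a u v; rewrite mulmxDl scalemxAl.
- exact: smooth_diff.
Qed.


(** The linear part of the derivative array as a map of (x', x''), whose two rows form W. *)
Definition xdot_rows (v : 'cV[R]_n) (W : 'M[R]_(1 + 1, N)) : 'M[R]_(1 + 1, N) :=
  let w1 := usubmx (row ord0 W)^T in let q1 := dsubmx (row ord0 W)^T in
  let w2 := usubmx (row ord_max W)^T in
  col_mx (col_mx (M *m w1) 0)^T
         (col_mx (M *m w2 + 'd K v w1 - B^T *m q1) (B *m w1))^T.

Lemma xdot_rows_linear v : linear (xdot_rows v).
Proof.
move=> c U W; rewrite /xdot_rows /= scale_col_mx add_col_mx -!linearP /=.
rewrite !scale_col_mx !add_col_mx scaler0 addr0.
congr (col_mx (col_mx _ _)^T (col_mx _ _)^T); rewrite !linearP //=.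
rewrite scalerBr scalerDr scalerN [RHS]addrACA; congr (_ + _).
by rewrite addrACA.
Qed.

Lemma mul_array_M1 (z : jet R N 3) (W : 'M[R]_(1 + 1, N)) :
  mxvec W *m (array_M F z)^T = mxvec (xdot_rows (usubmx (row ord0 z.2)^T) W).
Proof.
rewrite /array_M trmxK.
set x := row ord0 z.2.
have dG (y : 'rV[R]_((1 + 1) * N)) :
    mxvec (derivative_array F ((z.1, col_mx x (vec_mx y)) : jet R N 3) : 'M[R]_(1 + 1, N)) -
    mxvec (derivative_array F ((z.1, col_mx x (vec_mx 0)) : jet R N 3) : 'M[R]_(1 + 1, N)) =
    mxvec (xdot_rows (usubmx x^T) (vec_mx y)).
  rewrite !derivative_array1E // -raddfB; congr mxvec; move: (vec_mx y) => {}W.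
  rewrite !linear0 !mx_simp opp_col_mx add_col_mx -!raddfB /= !opp_col_mx !add_col_mx.
  rewrite subrr !opprK !subrK -!(addrA (M *m usubmx (row ord0 W)^T)).
  by rewrite subrr addr0.
rewrite jacobian_affine.
  by rewrite dG mxvecK.
by move=> c u w; rewrite !dG !linearP xdot_rows_linear linearP.
Qed.

(** The constraints extracted from the derivative array, seen as functions of x,
    contain K but not its derivatives. *)
Lemma constraint_rows_array t (x : 'rV[R]_N) (Y : 'M[R]_(2, N)) :
  constraint_rows (derivative_array F ((t, col_mx x Y) : jet R N 3)) =
  col_mx (B *m usubmx x^T - g t)^T
    (B *m invmx M *m (K (usubmx x^T) - B^T *m dsubmx x^T - f t) + 'd g t 1)^T.
Proof.
rewrite derivative_array1E // /constraint_rows.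
rewrite (@row_head R 1) // (@row_tail R 1 _ _ _ ord_max ord0) // !row_id.
rewrite !tr_col_mx !row_mxKr !row_mxKl; congr col_mx.
rewrite -trmx_mul -raddfB /= opprB addrA; congr (_^T).
rewrite -!(addrA (M *m _)) mulmxDr [_ *m (M *m _)]mulmxA mulmxKV //.
by rewrite addrC !addrA addNr add0r.
Qed.

Lemma smooth_array_x t (Y : 'M[R]_(2, N)) :
  smooth (fun x : 'rV[R]_N => mxvec (derivative_array F ((t, col_mx x Y) : jet R N 3))).
Proof.
pose w1 := usubmx (row ord0 Y)^T.
pose c0 : 'M[R]_(1 + 1, N) := col_mx (col_mx (M *m w1 - f t) (- g t))^T
  (col_mx (M *m usubmx (row ord_max Y)^T - B^T *m dsubmx (row ord0 Y)^T - 'd f t 1)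
     (B *m w1 - 'd g t 1))^T.
pose L1 (x : 'rV[R]_N) : 'M[R]_(1 + 1, N) :=
  col_mx (col_mx (- (B^T *m dsubmx x^T)) (B *m usubmx x^T))^T 0.
pose L2 (u : 'cV[R]_n) : 'M[R]_(1 + 1, N) := col_mx (col_mx u 0)^T 0.
pose L3 (u : 'cV[R]_n) : 'M[R]_(1 + 1, N) := col_mx 0 (col_mx u 0)^T.
have mc p q : linear_maps_continuous 'M[R]_(p, q) by exact: mx_linear_maps_continuous.
rewrite (_ : (fun x => _) = fun x => mxvec (c0 + (L1 x +
    (L2 (K (usubmx x^T)) + L3 ('d K (usubmx x^T) w1)))) : 'rV[R]_(2 * N)).
  apply: (smooth_linear_post (L := fun A : 'M[R]_(1 + 1, N) => mxvec A)).
  - exact: mc.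
  - by move=> a u v; rewrite linearP.
  apply: smooth_add; first exact: smooth_cst.
  apply: smooth_add.
    apply: smooth_linear; first exact: mc.
    move=> a u v; rewrite /L1 scale_col_mx add_col_mx scaler0 addr0.
    rewrite -!linearP /= scale_col_mx add_col_mx; congr (col_mx (col_mx _ _)^T _).
      by rewrite !linearP.
    by rewrite !linearP.
  have linu : linear (fun x : 'rV[R]_N => usubmx x^T) by move=> a u v; rewrite !linearP.
  apply: smooth_add.
    apply: (smooth_linear_post (L := L2) (h := fun x : 'rV[R]_N => K (usubmx x^T))).
    - exact: mc.
    - move=> a u v; rewrite /L2 scale_col_mx add_col_mx scaler0 addr0 -!linearP /=.
      by rewrite scale_col_mx add_col_mx scaler0 addr0.
    - by apply: (smooth_linear_pre (h := K)) => //; apply: mc.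
  apply: (smooth_linear_post (L := L3) (h := fun x : 'rV[R]_N => 'd K (usubmx x^T) w1)).
  - exact: mc.
  - move=> a u v; rewrite /L3 scale_col_mx add_col_mx scaler0 addr0 -!linearP /=.
    by rewrite scale_col_mx add_col_mx scaler0 addr0.
  - apply: (smooth_linear_pre (h := fun v => 'd K v w1)) => //; first exact: mc.
    exact: smooth_diff.
apply/funext => x; congr mxvec; rewrite derivative_array1E // /c0 /L1 /L2 /L3.
rewrite !add_col_mx !mx_simp -!raddfD /= !add_col_mx !mx_simp.
apply: (congr2 (@col_mx R 1 1 N)).
  congr ((col_mx _ _)^T); last by rewrite addrC.
  by rewrite [RHS]addrAC; congr (_ - _); rewrite -addrA (addrC (K _)).
congr ((col_mx _ _)^T).
by rewrite [RHS]addrAC; congr (_ - _); rewrite addrAC.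
Qed.

(** Composing with Z_2 before differentiating removes the second derivative of K
    that occurs in the Jacobian of dF/dt with respect to x. *)
Lemma mul_array_x_constraint (z : jet R N 3) (xi : 'rV[R]_N) :
  let v := usubmx (row ord0 z.2)^T in
  let w := usubmx xi^T in let q := dsubmx xi^T in
  xi *m (array_x F z)^T *m constraint_mx =
  mxvec (col_mx (B *m w)^T (B *m invmx M *m ('d K v w - B^T *m q))^T : 'M[R]_(1 + 1, m)).
Proof.
cbv zeta; rewrite /array_x trmxK; set x := row ord0 z.2.
have mc p q : linear_maps_continuous 'M[R]_(p, q) by exact: mx_linear_maps_continuous.
pose Gx (x : 'rV[R]_N) :=
  mxvec (derivative_array F ((z.1, col_mx x (row' ord0 z.2)) : jet R N 3)).
rewrite -[X in jacobian X]/Gx mul_rV_lin1.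
have dGx : is_diff x Gx ('d Gx x).
  by apply: differentiableP; apply: smooth_differentiable; apply: smooth_array_x.
have linC : linear (fun u : 'rV[R]_(2 * N) => u *m constraint_mx).
  by move=> a u v; rewrite mulmxDl scalemxAl.
have [_ D1] := is_diff_linear_post (mc _ _) linC dGx.
rewrite -[LHS](congr1 (@^~ xi) D1).
pose Bp := B *m invmx M.
pose c : 'rV[R]_((1 + 1) * m) :=
  mxvec (col_mx (- g z.1)^T ('d g (z.1) 1 - Bp *m f z.1)^T : 'M[R]_(1 + 1, m)).
pose L (x : 'rV[R]_N) : 'rV[R]_((1 + 1) * m) :=
  mxvec (col_mx (B *m usubmx x^T)^T (- (Bp *m (B^T *m dsubmx x^T)))^T : 'M[R]_(1 + 1, m)).
pose L2 (k : 'cV[R]_n) : 'rV[R]_((1 + 1) * m) :=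
  mxvec (col_mx 0 (Bp *m k)^T : 'M[R]_(1 + 1, m)).
have linL : linear L.
  move=> a u w; rewrite /L -linearP /=; congr mxvec.
  by rewrite scale_col_mx add_col_mx -!linearP /= !linearP.
have linL2 : linear L2.
  move=> a u w; rewrite /L2 -linearP /=; congr mxvec.
  by rewrite scale_col_mx add_col_mx scaler0 addr0 -!linearP.
have linu : linear (fun x : 'rV[R]_N => usubmx x^T) by move=> a u v; rewrite !linearP.
have D2 := is_diff_add (is_diff_cst c x) (is_diff_add (is_diff_linear x (mc _ _) linL)
  (is_diff_linear_post (mc _ _) linL2
    (is_diff_linear_pre (x := x) (mc _ _) linu (smooth_differentiable _ Ksmooth)))).
rewrite (_ : (fun x => _) = fun x => c + (L x + L2 (K (usubmx x^T)))); last first.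
  apply/funext => y; rewrite /Gx mul_constraint_mx constraint_rows_array /c /L /L2.
  rewrite -!linearD /=; congr mxvec; rewrite !add_col_mx addr0 -!linearD /=.
  congr (col_mx _^T _^T); first by rewrite addrC.
  rewrite !mulmxBr [LHS]addrC [RHS]addrAC addrA; congr (_ - _).
  by rewrite [X in _ + X]addrC.
case: D2 => _ D2; rewrite [LHS](congr1 (@^~ xi) D2).
rewrite /= add0r /L /L2 -!linearD /=; congr mxvec; rewrite add_col_mx addr0 -linearD /=.
by congr (col_mx _ _^T); rewrite addrC -mulmxBr.
Qed.

Lemma array_M_constraint (z : jet R N 3) :
  constraint_mx^T *m array_M F z = 0.
Proof.
apply: trmx_inj; rewrite trmx_mul [X in _ *m X]trmxK trmx0; apply: eq_mul_rV => y.
rewrite -(vec_mxK y) mulmx0 mulmxA (mul_array_M1 z (vec_mx y)) mul_constraint_mx.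
rewrite [constraint_rows _](_ : _ = 0) ?linear0 //.
rewrite /constraint_rows /xdot_rows.
rewrite (@row_head R 1) // (@row_tail R 1 _ _ _ ord_max ord0) // !row_id.
rewrite !tr_col_mx !row_mxKr !row_mxKl trmx0 -trmx_mul mulmxA mulmxKV //.
by rewrite subrr col_mx0.
Qed.

(** The columns of Z_2 bound the rank from above; from below, (v', v'') is
    recovered from its image because M is invertible. *)
Lemma mxrank_array_M (z : jet R N 3) :
  (\rank (array_M F z) + 2 * m)%N = (2 * N)%N.
Proof.
apply/eqP; rewrite eqn_leq; apply/andP; split.
  rewrite addnC -mxrank_constraint_mx -mxrank_tr.
  exact: mulmx0_rank_max (array_M_constraint z).
rewrite [X in (X <= _)%N]mulnDr leq_add2r -mxrank_tr.
pose emb (u : 'rV[R]_((1 + 1) * n)) : 'rV[R]_((1 + 1) * N) := mxvec (row_mx (vec_mx u) 0).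
have linemb : linear emb.
  move=> a u v; rewrite /emb -!linearP /= linearP; congr mxvec.
  by rewrite scale_row_mx add_row_mx scaler0 addr0.
have rX : \rank (lin1_mx emb *m (array_M F z)^T) = ((1 + 1) * n)%N.
  apply: mxrank_injective => u; rewrite mulmxA mul_rV_lin1_linear // /emb.
  rewrite mul_array_M1 -(vec_mxK u); move: (vec_mx u) => {}u; rewrite mxvecK.
  move=> h; have {h} : xdot_rows (usubmx (row ord0 z.2)^T) (row_mx u 0) = 0.
    by apply: (can_inj mxvecK); rewrite h linear0.
  move=> /col_mx0P[/(congr1 trmx)+ /(congr1 trmx)]; rewrite !trmxK !trmx0.
  rewrite !row_row_mx !tr_row_mx !col_mxKu !col_mxKd.
  move=> /col_mx0P[/(congr1 (mulmx (invmx M)))]; rewrite mulKmx // mulmx0 => u0 _.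
  rewrite u0 row0 trmx0 !linear0 !mx_simp => /col_mx0P[+ _].
  move=> /(congr1 (mulmx (invmx M))); rewrite mulKmx // mulmx0 => u1.
  rewrite [u](_ : _ = 0) ?linear0 //; apply/row_matrixP => i; apply: trmx_inj.
  rewrite row0 trmx0; case: i => [[|[|i]] // hi].
    by rewrite -[RHS]u0; congr (_^T); congr row; apply: val_inj.
  by rewrite -[RHS]u1; congr (_^T); congr row; apply: val_inj.
by rewrite -[X in (X <= _)%N]rX mxrankM_maxr.
Qed.

(** Given prescribed right-hand sides, the velocity is found from B v = b_0 and the
    pressure from the hidden constraint, whose coefficient of p is - B M^-1 B^T. *)
Lemma mxrank_array_x_constraint (z : jet R N 3) :
  \rank ((array_x F z)^T *m constraint_mx) = (2 * m)%N.
Proof.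
apply: mxrank_surjective => y; rewrite -(vec_mxK y); move: (vec_mx y : 'M[R]_(1 + 1, m)) => U.
set v := usubmx (row ord0 z.2)^T.
pose w := invmx M *m B^T *m invmx S *m (row ord0 U)^T.
have Bw : B *m w = (row ord0 U)^T by rewrite /w !mulmxA mulmxV ?mul1mx.
pose q := invmx S *m (B *m invmx M *m 'd K v w - (row ord_max U)^T).
exists (col_mx w q)^T; rewrite mulmxA mul_array_x_constraint trmxK col_mxKu col_mxKd.
rewrite Bw trmxK mulmxBr mulmxA mulKVmx // opprB addrC subrK trmxK.
congr mxvec; apply/row_matrixP => i; case: i => [[|[|i]] // hi].
  by rewrite (@row_head R 1) //; congr row; apply: val_inj.
by rewrite (@row_tail R 1 _ _ _ _ ord0) // row_id; congr row; apply: val_inj.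
Qed.

(** The kernel of the linearized constraints: velocities in the kernel of B, with
    the pressure determined by the hidden constraint. *)
Definition differential_directions d (T : 'M[R]_(n, d)) (v : 'cV[R]_n) : 'M[R]_(N, d) :=
  col_mx T (invmx S *m (B *m invmx M) *m convection_mx v *m T).

Lemma differential_directions_constraint d (T : 'M[R]_(n, d)) (z : jet R N 3) :
  B *m T = 0 ->
  (array_x F z *m differential_directions T (usubmx (row ord0 z.2)^T))^T *m constraint_mx = 0.
Proof.
move=> BT; rewrite trmx_mul; apply: eq_mul_rV => c; rewrite !mulmxA mulmx0.
rewrite -[c *m _]trmxK trmx_mul trmxK mul_col_mx mul_array_x_constraint.
rewrite trmxK col_mxKu col_mxKd; set v := usubmx _.
have -> : invmx S *m (B *m invmx M) *m convection_mx v *m T *m c^T =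
    invmx S *m (B *m invmx M *m 'd K v (T *m c^T)).
  by move: (invmx S) (B *m invmx M) => Si Bp; rewrite -mul_convection_mx !mulmxA.
rewrite [B *m (T *m _)]mulmxA BT mul0mx trmx0 mulmxBr [X in _ - X]mulmxA mulKVmx //.
by rewrite subrr trmx0 col_mx0 linear0.
Qed.

Lemma smooth_differential_directions d (T : 'M[R]_(n, d)) :
  smooth (fun z : jet R N 3 => differential_directions T (usubmx (row ord0 z.2)^T)).
Proof.
have mc p q : linear_maps_continuous 'M[R]_(p, q) by exact: mx_linear_maps_continuous.
have cJ : linear_maps_continuous (jet R N 3).
  by apply: pair_linear_maps_continuous; [exact: scalar_linear_maps_continuous|exact: mc].
pose L (A : 'M[R]_n) : 'M[R]_(N, d) := col_mx 0 (invmx S *m (B *m invmx M) *m A *m T).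
rewrite (_ : (fun z => _) = fun z : jet R N 3 => (col_mx T 0 : 'M[R]_(N, d)) +
    L (convection_mx (usubmx (row ord0 z.2)^T))); last first.
  by apply/funext => z; rewrite add_col_mx addr0 add0r.
apply: smooth_add; first exact: smooth_cst.
apply: (smooth_linear_post (L := L)
  (h := fun z : jet R N 3 => convection_mx (usubmx (row ord0 z.2)^T))).
- exact: mc.
- move=> a A A'; rewrite /L scale_col_mx add_col_mx scaler0 addr0.
  by rewrite mulmxDr mulmxDl -scalemxAr -scalemxAl.
- apply: (smooth_linear_pre (h := convection_mx)
    (L := fun z : jet R N 3 => usubmx (row ord0 z.2)^T)) => //.
  + by move=> a u v; rewrite !linearP.
  + exact: smooth_convection_mx.
Qed.

(** T is a basis of the kernel of B, T_2 is [differential_directions] and Z_1 is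
    [T; 0]; thus F_x' T_2 is [M T; 0], and Z_1^T F_x' T_2 is T^T M T, which is
    positive definite. *)
Lemma ns_strangeness_hypothesis1 (I : set R) :
  (m <= n)%N -> @jet_solutions R N F I 1 !=set0 ->
  strangeness_hypothesis_with F I 1 (2 * m) (n - m).
Proof.
move=> mn ne; split=> //; first by rewrite mul2n -addnn addnA subnK.
have [T [BT rT]] := kernel_basis Brank.
move=> z0 _; exists setT, (fun=> constraint_mx),
  (fun z => differential_directions T (usubmx (row ord0 z.2)^T)), (fun=> col_mx T 0).
have T_inj (y : 'cV[R]_(n - m)) : T *m y = 0 -> y = 0.
  move=> Ty; apply: trmx_inj; rewrite trmx0.
  have /row_free_inj : row_free T^T by rewrite /row_free mxrank_tr rT.
  by apply; rewrite mul0mx -trmx_mul Ty trmx0.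
split; first by split=> //; exact: openT.
  split; [exact: smooth_cst|exact: smooth_differential_directions|exact: smooth_cst].
move=> z _ _; cbv zeta.
have eA : constraint_mx^T *m array_N F z *m col_mx 1%:M 0 =
    - ((array_x F z)^T *m constraint_mx)^T.
  rewrite /array_N mulmxN mulNmx -mulmxA mul_row_col mulmx1 mul0mx addr0.
  by rewrite trmx_mul trmxK.
rewrite eA ns_jac_xdot; split; split.
- exact: mxrank_array_M.
- exact: mxrank_constraint_mx.
- exact: array_M_constraint.
- by rewrite mxrank_opp mxrank_tr; apply: mxrank_array_x_constraint.
- apply: mxrank_injective_tr => y; rewrite mul_col_mx => /col_mx0P[+ _]; exact: T_inj.
- apply: trmx_inj; rewrite mulNmx trmx0 linearN /= trmx_mul trmxK mulmxA -trmx_mul.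
  by rewrite differential_directions_constraint // oppr0.
- apply: mxrank_injective_tr => y; rewrite mul_block_col !mx_simp mul_col_mx.
  by move=> /col_mx0P[]; rewrite -mulmxA => /(congr1 (mulmx (invmx M)));
    rewrite mulKmx // mulmx0 => /T_inj.
- by apply: mxrank_injective_tr => y; rewrite mul_col_mx => /col_mx0P[+ _]; exact: T_inj.
- apply: mxrank_injective_tr => y; rewrite tr_col_mx mul_row_block mul_row_col !mx_simp.
  move=> /(congr1 (mulmx y^T)); rewrite !mulmxA mulmx0 -trmx_mul -mulmxA.
  by move=> /(posdef_eq0 Mpos)/T_inj.
Qed.

End SecondArray.

(** * Derivative arrays of arbitrary order and the differentiation index *)
Section Jets.
Variables (R : realType) (n m : nat).
Variables (M : 'M[R]_n) (K : 'cV[R]_n -> 'cV[R]_n) (B : 'M[R]_(m, n)).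
Variables (f : R -> 'cV[R]_n) (g : R -> 'cV[R]_m).
Hypothesis Ksmooth : smooth K.
Hypothesis fsmooth : smooth f.
Hypothesis gsmooth : smooth g.

Local Notation F := (ns_dae M K B f g).
Local Notation N := (n + m)%N.

Definition velocity k (X : 'M[R]_(k.+1, N)) (j : nat) : 'cV[R]_n :=
  usubmx (row (inord j) X)^T.

Definition pressure k (X : 'M[R]_(k.+1, N)) (j : nat) : 'cV[R]_m :=
  dsubmx (row (inord j) X)^T.

Definition velocities (i : nat) (v : nat -> 'cV[R]_n) : 'M[R]_(i.+1, n) :=
  \matrix_(j < i.+1) (v j)^T.

Lemma derivative_array_eq0 mu (z : jet R N mu.+2) :
  derivative_array F z = 0 <->
  forall i, (i <= mu)%N ->
    M *m velocity z.2 i.+1 + convection K (velocities i (velocity z.2))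
      - B^T *m pressure z.2 i = time_derivative i f z.1 /\
    B *m velocity z.2 i = time_derivative i g z.1.
Proof.
pose Xi (i : 'I_mu.+1) : 'M[R]_(i.+2, N) := rowsub (fun j : 'I_i.+2 => inord j : 'I_mu.+2) z.2.
have e1 i : row ord_max (Xi i) = row (inord i.+1) z.2 by rewrite row_rowsub.
have e2 i : row ord_max (row' ord_max (Xi i)) = row (inord i) z.2.
  by rewrite row_row' row_rowsub; congr row; congr inord; rewrite lift_max.
have e3 (i : 'I_mu.+1) : lsubmx (row' ord_max (Xi i)) = velocities i (velocity z.2).
  apply/row_matrixP => j; rewrite rowK; apply: trmx_inj.
  rewrite tr_row_lsubmx row_row' row_rowsub trmxK /velocity.
  by congr (usubmx (row (inord _) _)^T); rewrite lift_max.
have rowE i : (row i (derivative_array F z))^T =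
    col_mx (M *m velocity z.2 i.+1 + convection K (velocities i (velocity z.2))
            - B^T *m pressure z.2 i - time_derivative i f z.1)
           (B *m velocity z.2 i - time_derivative i g z.1).
  by rewrite rowK trmxK total_derivativeE // -/(Xi i) e1 e2 e3.
split=> [D0 i|eqs].
  rewrite -ltnS => imu; have := rowE (Ordinal imu); rewrite D0 row0 trmx0.
  by move=> /esym/col_mx0P[/subr0_eq-> /subr0_eq->].
apply/row_matrixP => i; apply: trmx_inj; rewrite row0 trmx0 rowE.
have [] := eqs i; first by rewrite -ltnS.
by move=> -> ->; rewrite !subrr col_mx0.
Qed.

Definition jet_matrix k (v : nat -> 'cV[R]_n) (p : nat -> 'cV[R]_m) : 'M[R]_(k.+1, N) :=
  \matrix_(j < k.+1) (col_mx (v j) (p j))^T.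

Lemma velocity_jet_matrix k v p j : (j <= k)%N -> velocity (jet_matrix k v p) j = v j.
Proof. by move=> jk; rewrite /velocity rowK trmxK col_mxKu inordK. Qed.

Lemma pressure_jet_matrix k v p j : (j <= k)%N -> pressure (jet_matrix k v p) j = p j.
Proof. by move=> jk; rewrite /pressure rowK trmxK col_mxKd inordK. Qed.

Lemma eq_velocities i (v v' : nat -> 'cV[R]_n) :
  (forall j, (j <= i)%N -> v j = v' j) -> velocities i v = velocities i v'.
Proof. by move=> eqv; apply/row_matrixP => j; rewrite !rowK eqv // -ltnS. Qed.

Hypothesis Msym : M^T = M.
Hypothesis Mpos : forall v : 'cV[R]_n, v != 0 -> 0 < (v^T *m M *m v) 0 0.
Local Notation S := (B *m invmx M *m B^T).

(** At each order the pressure is chosen so that the next velocity derivative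
    satisfies the differentiated constraint. *)
Lemma formal_solution t k : \rank B = m ->
  exists (v : nat -> 'cV[R]_n) (p : nat -> 'cV[R]_m),
    (forall i, (i < k)%N -> M *m v i.+1 + convection K (velocities i v)
      - B^T *m p i = time_derivative i f t) /\
    (forall i, (i <= k)%N -> B *m v i = time_derivative i g t).
Proof.
move=> rB; have uM := posdef_unit Mpos; have uS := schur_unit Msym Mpos rB.
elim: k => [|k [v [p [dyn con]]]].
  exists (fun=> invmx M *m B^T *m invmx S *m g t), (fun=> 0); split=> // i.
  by rewrite leqn0 => /eqP->; rewrite !mulmxA mulmxV ?mul1mx.
pose r := time_derivative k f t - convection K (velocities k v).
pose pk := invmx S *m (time_derivative k.+1 g t - B *m invmx M *m r).
pose vk := invmx M *m (r + B^T *m pk).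
pose v' j := if (j <= k)%N then v j else vk.
pose p' j := if (j < k)%N then p j else pk.
have ev i : (i <= k)%N -> velocities i v' = velocities i v.
  by move=> ik; apply: eq_velocities => j ji; rewrite /v' (leq_trans ji).
exists v', p'; split=> i; rewrite ?ltnS leq_eqVlt => /predU1P[->|ik].
- rewrite ev // /v' /p' !ltnn /vk mulKVmx //.
  by rewrite addrAC addrK subrK.
- by rewrite ev ?(ltnW ik) // /v' /p' ik dyn.
- rewrite /v' ltnn /vk mulmxA mulmxDr [B *m invmx M *m (B^T *m _)]mulmxA.
  by rewrite mulKVmx // addrC subrK.
- by rewrite /v' -ltnS ik con.
Qed.

Lemma jet_solutions_nonempty (I : set R) mu : \rank B = m -> I !=set0 ->
  @jet_solutions R N F I mu !=set0.
Proof.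
move=> rB [t It]; have [v [p [dyn con]]] := formal_solution t mu.+1 rB.
exists (t, jet_matrix mu.+1 v p); split=> //; apply/derivative_array_eq0 => i imu /=.
rewrite !velocity_jet_matrix ?pressure_jet_matrix ?(leq_trans imu) ?leqnSn //.
rewrite con ?(leq_trans imu) // -dyn ?ltnS //; split=> //; congr (_ + convection K _ - _).
by apply: eq_velocities => j ji; rewrite velocity_jet_matrix // (leq_trans ji) // (leq_trans imu).
Qed.

Lemma jet_row0 k (X : 'M[R]_(k.+1, N)) :
  (row ord0 X)^T = col_mx (velocity X 0) (pressure X 0).
Proof. by rewrite vsubmxK; congr (row _ X)^T; apply: val_inj; rewrite /= inordK. Qed.

Lemma jet_row1 k (X : 'M[R]_(k.+2, N)) :
  (row (lift ord0 ord0) X)^T = col_mx (velocity X 1) (pressure X 1).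
Proof. by rewrite vsubmxK; congr (row _ X)^T; apply: val_inj; rewrite /= inordK. Qed.

(** Two solutions of the derivative array that agree in t and x but not in x'
    rule out an explicit equation x' = phi(t, x). *)
Lemma explicit_ode_pressure (I : set R) nu (z : jet R N nu.+2)
    (v : nat -> 'cV[R]_n) (p : nat -> 'cV[R]_m) :
  yields_explicit_ode F I nu -> jet_solutions F I z ->
  jet_solutions F I (z.1, jet_matrix nu.+1 v p) ->
  v 0%N = velocity z.2 0 -> p 0%N = pressure z.2 0 -> p 1%N = pressure z.2 1.
Proof.
move=> [_ [D [phi [_ _ ode]]]] zsol zsol' ev ep.
have [_] := ode _ zsol; have [_] := ode _ zsol' => /=.
rewrite !jet_row0 !jet_row1 !velocity_jet_matrix // !pressure_jet_matrix // ev ep => <-.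
by move=> /eq_col_mx[].
Qed.

(** Adding q to p' and M^-1 B^T q to v'' leaves F and dF/dt unchanged, and d^2F/dt^2
    is not yet available to fix v''. *)
Lemma no_explicit_ode (I : set R) nu : (0 < m)%N -> (nu <= 1)%N ->
  ~ yields_explicit_ode F I nu.
Proof.
move=> m0 nu1 ode; have [[z zsol] _] := ode.
have [It /derivative_array_eq0 eqs] := zsol; have uM := posdef_unit Mpos.
pose q : 'cV[R]_m := const_mx 1.
pose v j := velocity z.2 j + (if j == 2 then invmx M *m (B^T *m q) else 0).
pose p j := pressure z.2 j + (if j == 1%N then q else 0).
have q0 : q != 0.
  apply/eqP => /matrixP/(_ (Ordinal m0) 0); rewrite !mxE; exact/eqP/oner_neq0.
case/eqP: q0; apply: (addrI (pressure z.2 1)); rewrite addr0.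
apply: (explicit_ode_pressure (p := p) (v := v) ode zsol); rewrite /v /p ?addr0 //.
split=> //; apply/derivative_array_eq0 => i inu /=; have [e1 e2] := eqs i inu.
rewrite !velocity_jet_matrix ?pressure_jet_matrix ?(leq_trans inu) ?leqnSn //.
rewrite (@eq_velocities i _ (velocity z.2)); last first.
  move=> j ji; rewrite velocity_jet_matrix ?(leq_trans ji) ?(leq_trans inu) //.
  rewrite ifN ?addr0 // ltn_eqF // ltnS; exact: leq_trans ji (leq_trans inu nu1).
move: (leq_trans inu nu1) e1 e2; case: i {inu} => [|[|//]] _ /=; rewrite ?addr0 //.
move=> <- ->; split=> //; rewrite !mulmxDr mulKVmx // opprD.
by rewrite [X in X + _]addrAC -[LHS]addrA [B^T *m q + _]addrC subrK.
Qed.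

(** The arrays depend on p^(j) through B^T p^(j) only. *)
Lemma no_explicit_ode_deficient (I : set R) nu : (\rank B < m)%N ->
  ~ yields_explicit_ode F I nu.
Proof.
move=> rB ode; have [[z zsol] _] := ode.
have [It /derivative_array_eq0 eqs] := zsol.
have : kermx B != 0 by rewrite kermx_eq0 /row_free neq_ltn rB.
rewrite -nz_row_eq0; set c := nz_row _ => c0.
have Bc : B^T *m c^T = 0.
  have /sub_kermxP cB : (c <= kermx B)%MS by exact: nz_row_sub.
  by rewrite -trmx_mul cB trmx0.
pose p j := pressure z.2 j + (if j == 1%N then c^T else 0).
case/eqP: c0; apply: trmx_inj; rewrite trmx0.
apply: (addrI (pressure z.2 1)); rewrite addr0.
apply: (explicit_ode_pressure (p := p) (v := velocity z.2) ode zsol); rewrite /p ?addr0 //.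
split=> //; apply/derivative_array_eq0 => i inu /=; have [<- <-] := eqs i inu.
rewrite !velocity_jet_matrix ?pressure_jet_matrix ?(leq_trans inu) ?leqnSn //.
split=> //; rewrite mulmxDr (_ : B^T *m (if _ then _ else _) = 0); last first.
  by case: ifP; rewrite ?Bc ?mulmx0.
rewrite addr0; congr (_ + convection K _ - _); apply: eq_velocities => j ji.
by rewrite velocity_jet_matrix // (leq_trans ji) // (leq_trans inu).
Qed.

Hypothesis Brank : \rank B = m.

(** v' as determined by the momentum equation. *)
Definition explicit_velocity (x : R * 'cV[R]_N) : 'cV[R]_n :=
  invmx M *m (f x.1 - K (usubmx x.2) + B^T *m dsubmx x.2).

(** The second component is p', obtained by inserting
    v'' = M^-1 (f' - K'(v) v' + B^T p') into B v'' = g''. *)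
Definition explicit_rhs (x : R * 'cV[R]_N) : 'cV[R]_N :=
  col_mx (explicit_velocity x)
    (invmx S *m (B *m invmx M *m ('d K (usubmx x.2) (explicit_velocity x)
       - time_derivative 1 f x.1) + time_derivative 2 g x.1)).

Lemma smooth_explicit_rhs : smooth explicit_rhs.
Proof.
have mc p q : linear_maps_continuous 'M[R]_(p, q) by exact: mx_linear_maps_continuous.
have cJ : linear_maps_continuous (R * 'cV[R]_N)%type.
  by apply: pair_linear_maps_continuous; [exact: scalar_linear_maps_continuous|exact: mc].
have linu : linear (fun x : R * 'cV[R]_N => usubmx x.2) by move=> a u v; rewrite linearP.
have lin1 : linear (fst : R * 'cV[R]_N -> R) by [].
have sm_mul p q r (A : 'M[R]_(p, q)) (h : R * 'cV[R]_N -> 'M[R]_(q, r)) :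
    smooth h -> smooth (fun x => A *m h x).
  move=> sh; apply: (smooth_linear_post (L := mulmx A)) => //; first exact: mc.
  by move=> a u v; rewrite linearP.
have sm_opp p q (h : R * 'cV[R]_N -> 'M[R]_(p, q)) : smooth h -> smooth (fun x => - h x).
  move=> sh; apply: (smooth_linear_post (L := -%R)) => //; first exact: mc.
  by move=> a u v; rewrite linearP.
have sm_time p q (h : R -> 'M[R]_(p, q)) : smooth h -> smooth (fun x : R * 'cV[R]_N => h x.1).
  by move=> sh; apply: (smooth_linear_pre (L := fst)).
have sm_v : smooth explicit_velocity.
  apply: (sm_mul); apply: smooth_add; first apply: smooth_add.
  - exact: sm_time.
  - apply: (sm_opp); exact: (smooth_linear_pre (h := K) cJ linu).
  - apply: (sm_mul); apply: smooth_linear => // a u v; by rewrite linearP.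
rewrite (_ : explicit_rhs = fun x =>
    col_mx (explicit_velocity x) 0 + col_mx 0 (dsubmx (explicit_rhs x))).
  apply: smooth_add.
    apply: (smooth_linear_post (L := fun u : 'cV[R]_n => col_mx u 0 : 'cV[R]_N)) => //;
      first exact: mc.
    by move=> a u v; rewrite scale_col_mx add_col_mx scaler0 addr0.
  apply: (smooth_linear_post (L := fun u : 'cV[R]_m => col_mx 0 u : 'cV[R]_N)).
  - exact: mc.
  - by move=> a u v; rewrite scale_col_mx add_col_mx scaler0 addr0.
  under eq_fun do rewrite col_mxKd.
  apply: (sm_mul); apply: smooth_add; last first.
    by apply: (sm_time); apply: smooth_time_derivative.
  apply: (sm_mul); apply: smooth_add; first exact: smooth_diff_apply.
  by apply: (sm_opp); apply: (sm_time); apply: smooth_time_derivative.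
by apply/funext => x; rewrite add_col_mx addr0 add0r col_mxKd.
Qed.

Lemma ns_explicit_ode (I : set R) : I !=set0 -> yields_explicit_ode F I 2.
Proof.
move=> I0; split; first exact: jet_solutions_nonempty.
have uM := posdef_unit Mpos; have uS := schur_unit Msym Mpos Brank.
exists setT, explicit_rhs; split; [exact: openT|exact: smooth_explicit_rhs|].
move=> z [_ /derivative_array_eq0 eqs]; cbv zeta; split=> //.
have [+ _] := eqs 0%N isT; have [+ _] := eqs 1%N isT; have [_] := eqs 2%N isT.
rewrite convection0 convection1 // !rowK !trmxK [time_derivative 0 f _]/= => c2 d1 d0.
change (nat_of_ord ord0) with 0%N in d0, d1; change (nat_of_ord ord_max) with 1%N in d1.
have ev : velocity z.2 1 = explicit_velocity (z.1, (row ord0 z.2)^T).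
  rewrite /explicit_velocity /= jet_row0 col_mxKu col_mxKd -d0.
  by rewrite [X in X + _]addrAC addrK subrK mulKmx.
rewrite jet_row1 /explicit_rhs -ev [(_, _).1]/= [(_, _).2]/= jet_row0 col_mxKu.
congr col_mx.
rewrite -[LHS](mulKmx uS); congr (_ *m _).
rewrite -c2 -d1 -[X in _ = _ + B *m X](mulKmx uM) [B *m (invmx M *m _)]mulmxA.
rewrite -mulmxDr -[LHS]mulmxA; congr (_ *m _).
move: ('d K _ _) (M *m _) (B^T *m _) => a b c.
by rewrite opprB [b + a]addrC addrA [a + c]addrC addrKA subrK.
Qed.

Lemma ns_differentiation_index (I : set R) : (0 < m)%N -> I !=set0 ->
  differentiation_index F I 2.
Proof.
move=> m0 I0; split; first exact: ns_explicit_ode.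
by move=> i i2; apply: no_explicit_ode.
Qed.

End Jets.

(** * The strangeness hypothesis with mu = 0 *)
Section ZerothArray.
Variables (R : realType) (N : nat).

Lemma derivative_array0E (G : dae R N) t (x : 'rV[R]_N) (Y : 'M[R]_(1, N)) :
  derivative_array G ((t, col_mx x Y) : jet R N 2) = (G t x^T Y^T)^T.
Proof.
apply/row_matrixP => i; rewrite (ord1 i) rowK row_id /=; congr ((G t _^T _^T)^T).
  rewrite row_rowsub (@row_head R 1) // inordK //.
rewrite row_rowsub (@row_tail R 1 _ _ _ _ ord0) ?row_id // inordK //.
Qed.

(** 'rV_N and 'rV_(1 * N) are different types; these inverse matrices translate
    between the array, whose size is 1 * N, and the DAE. *)
Let mxvec_mx : 'M[R]_(N, 1 * N) := lin1_mx (fun u : 'rV_N => mxvec u).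
Let vec_mx_mx : 'M[R]_(1 * N, N) := lin1_mx (fun u => vec_mx u : 'rV_N).

Let mul_mxvec_mx (u : 'rV_N) : u *m mxvec_mx = mxvec u.
Proof. by rewrite mul_rV_lin1_linear // => a x y; rewrite linearP. Qed.

Let mul_vec_mx_mx (u : 'rV_(1 * N)) : u *m vec_mx_mx = vec_mx u.
Proof. by rewrite mul_rV_lin1_linear // => a x y; rewrite linearP. Qed.

Let mxvec_mxK : mxvec_mx *m vec_mx_mx = 1%:M.
Proof. by apply: eq_mul_rV => u; rewrite mulmxA mul_mxvec_mx mul_vec_mx_mx mxvecK mulmx1. Qed.

Let vec_mx_mxK : vec_mx_mx *m mxvec_mx = 1%:M.
Proof. by apply: eq_mul_rV => u; rewrite mulmxA mul_vec_mx_mx mul_mxvec_mx vec_mxK mulmx1. Qed.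

(** For index 0, the matrices Z_2 and T_2 span the left kernel of E and a
    complement of its kernel; that Z_2^T A vanishes on T_2 therefore means that
    the equations in the cokernel of E are determined by their restriction to the
    kernel of E. *)
Lemma hypothesis0_strangeness_free (G : dae R N) (I : set R) (E : 'M[R]_N)
    (Phi : R -> 'cV[R]_N -> 'cV[R]_N) :
  (forall t x xdot, G t x xdot = E *m xdot + Phi t x) ->
  (forall t x, differentiable (Phi t) x) ->
  strangeness_hypothesis G I 0 ->
  exists t x (A : 'M[R]_N),
    (forall h, 'd (Phi t) x h = A *m h) /\ strangeness_free E A.
Proof.
move=> GE dPhi [a [d [da [z zsol] /(_ z zsol)]]].
move=> [U [Z2 [T2 [Z1 [[_ Uz] _ /(_ z zsol Uz)]]]]]; cbv zeta.
move=> [[rM rZ Z0] [_ _ AT] [rET _ _]].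
pose x := (row ord0 z.2)^T.
pose A := (lin1_mx (fun h : 'rV_N => ('d (Phi z.1) x h^T)^T))^T.
have dA h : 'd (Phi z.1) x h = A *m h.
  apply: trmx_inj; rewrite trmx_mul trmxK mul_rV_lin1_linear ?trmxK // => c u v.
  by rewrite !linearP.
exists z.1, x, A; split=> //.
have eJ : jac_xdot G z = E.
  apply: trmx_inj; rewrite trmxK; apply: eq_mul_rV => y.
  have eG (u : 'rV_N) : (G z.1 x u^T)^T - (G z.1 x (0 : 'rV_N)^T)^T = u *m E^T.
    by rewrite -raddfB /= !GE trmx0 mulmx0 add0r addrK trmx_mul trmxK.
  by rewrite jacobian_affine ?eG // => c u v; rewrite !eG mulmxDl scalemxAl.
have eM : (array_M G z)^T = vec_mx_mx *m E^T *m mxvec_mx.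
  apply: eq_mul_rV => y; rewrite trmxK.
  have eG (u : 'rV_(1 * N)) :
      mxvec (derivative_array G ((z.1, col_mx (row ord0 z.2) (vec_mx u)) : jet R N 2)) -
      mxvec (derivative_array G ((z.1, col_mx (row ord0 z.2) (vec_mx 0)) : jet R N 2)) =
      u *m (vec_mx_mx *m E^T *m mxvec_mx).
    rewrite -raddfB /= !derivative_array0E -raddfB /= !GE opprD addrACA subrr addr0.
    by rewrite !linear0 addr0 !mulmxA mul_vec_mx_mx mul_mxvec_mx trmx_mul trmxK.
  by rewrite jacobian_affine ?eG // => c u v; rewrite !eG mulmxDl scalemxAl.
have eX : (array_x G z)^T = A^T *m mxvec_mx.
  apply: eq_mul_rV => y; rewrite trmxK mul_rV_lin1.
  have mc p q : linear_maps_continuous 'M[R]_(p, q) by exact: mx_linear_maps_continuous.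
  have lint : linear (fun u : 'rV[R]_N => u^T) by move=> c u v; rewrite linearP.
  have linv : linear (fun u : 'cV[R]_N => mxvec u^T) by move=> c u v; rewrite !linearP.
  pose c := mxvec (E *m (row' ord0 z.2)^T)^T.
  have D := is_diff_add (is_diff_cst c (row ord0 z.2)) (is_diff_linear_post (mc _ _) linv
    (is_diff_linear_pre (x := row ord0 z.2) (mc _ _) lint (dPhi z.1 x))).
  rewrite (_ : (fun x => _) = fun y => c + mxvec (Phi z.1 y^T)^T); last first.
    by apply/funext => u; rewrite derivative_array0E GE -!linearD.
  case: D => _ D; rewrite [LHS](congr1 (@^~ y) D) /= add0r dA trmx_mul trmxK.
  by rewrite mulmxA mul_mxvec_mx.
pose Y := (mxvec_mx *m Z2 z)^T.
have rY : \rank Y = a.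
  rewrite /Y mxrank_tr -[RHS]rZ; apply/eqP; rewrite eqn_leq mxrankM_maxr /=.
  by rewrite -[X in (\rank X <= _)%N]mul1mx -vec_mx_mxK -mulmxA mxrankM_maxr.
have YE : Y *m E = 0.
  apply: trmx_inj; rewrite trmx_mul trmxK trmx0.
  have := congr1 trmx Z0; rewrite trmx_mul eM trmxK trmx0 -!mulmxA.
  by move=> /(congr1 (mulmx mxvec_mx)); rewrite !mulmxA mxvec_mxK mul1mx mulmx0.
have rE : (\rank E + a)%N = N.
  rewrite -[RHS]mul1n -[RHS]rM -[in RHS]mxrank_tr eM -(mxrank_tr E); congr (_ + _)%N.
  apply/eqP; rewrite eqn_leq; apply/andP; split; last first.
    exact: leq_trans (mxrankM_maxl _ _) (mxrankM_maxr _ _).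
  have {1}-> : E^T = mxvec_mx *m (vec_mx_mx *m E^T *m mxvec_mx) *m vec_mx_mx.
    by rewrite !mulmxA mxvec_mxK mul1mx -mulmxA mxvec_mxK mulmx1.
  exact: leq_trans (mxrankM_maxl _ _) (mxrankM_maxr _ _).
have YAT : Y *m A *m T2 z = 0.
  move: AT; rewrite /array_N mulmxN mulNmx -mulmxA mul_row_col mulmx1 mul0mx addr0.
  move=> /eqP; rewrite mulNmx oppr_eq0 => /eqP.
  by rewrite -[array_x G z]trmxK eX trmx_mul trmxK mulmxA -trmx_mul.
have rET' : \rank (E *m T2 z) = \rank E.
  by apply/eqP; rewrite -(eqn_add2r a) rE -eJ rET da.
move=> w wE wA; apply/rowP => j.
have /submxP[c wY] : (w <= Y)%MS.
  have YkE : (Y <= kermx E)%MS by apply/sub_kermxP.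
  have := mxrank_leqif_sup YkE; rewrite rY mxrank_ker => -[_].
  rewrite -{1}rE addKn eqxx => /esym; apply: submx_trans; exact/sub_kermxP.
have [D eD] : exists D, E = E *m T2 z *m D.
  have sub : ((E *m T2 z)^T <= E^T)%MS by rewrite trmx_mul submxMl.
  have := mxrank_leqif_sup sub; rewrite !mxrank_tr rET' => -[_].
  rewrite eqxx => /esym/submxP[D eD]; exists D^T.
  by apply: trmx_inj; rewrite trmx_mul trmxK.
have wAT : w *m A *m T2 z = 0 by rewrite wY -!mulmxA [Y *m (A *m _)]mulmxA YAT mulmx0.
have := wA (delta_mx j 0 - T2 z *m (D *m delta_mx j 0)).
rewrite mulmxBr !mulmxA -eD subrr => /(_ erefl).
rewrite mulmxBr !mulmxA wAT !mul0mx subr0 -colE => /matrixP/(_ 0 0).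
by rewrite !mxE.
Qed.

End ZerothArray.

Section Redundancy.
Variables (R : realType) (n m : nat).
Variables (M : 'M[R]_n) (K : 'cV[R]_n -> 'cV[R]_n) (B : 'M[R]_(m, n)).
Variables (f : R -> 'cV[R]_n) (g : R -> 'cV[R]_m).
Hypothesis Ksmooth : smooth K.

Local Notation F := (ns_dae M K B f g).
Local Notation N := (n + m)%N.

Lemma ns_dae_quasilinear t x xdot : F t x xdot = block_mx M 0 0 0 *m xdot + F t x 0.
Proof.
rewrite /ns_dae -{2}[xdot]vsubmxK mul_block_col !mx_simp linear0 mulmx0 add_col_mx.
by rewrite !add0r !addrA.
Qed.

Lemma is_diff_ns_dae t x : is_diff x (fun x => F t x 0)
  (fun h => block_mx (convection_mx K (usubmx x)) (- B^T) B 0 *m h).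
Proof.
have mc p q : linear_maps_continuous 'M[R]_(p, q) by exact: mx_linear_maps_continuous.
have linu : linear (usubmx : 'cV[R]_N -> 'cV[R]_n) by move=> a u v; rewrite linearP.
have linup : linear (fun u : 'cV[R]_n => col_mx u 0 : 'cV[R]_N).
  by move=> c u v; rewrite scale_col_mx add_col_mx scaler0 addr0.
have linA : linear (mulmx (block_mx 0 (- B^T) B 0) : 'cV[R]_N -> 'cV[R]_N).
  by move=> a u v; rewrite linearP.
have [D1 D2] := is_diff_add (is_diff_cst (col_mx (- f t) (- g t)) x)
  (is_diff_add (is_diff_linear x (mc _ _) linA) (is_diff_linear_post (mc _ _) linup
  (is_diff_linear_pre (x := x) (mc _ _) linu (smooth_differentiable _ Ksmooth)))).
rewrite (_ : (fun x => _) = fun y => col_mx (- f t) (- g t) +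
    (block_mx 0 (- B^T) B 0 *m y + col_mx (K (usubmx y)) 0)); last first.
  apply/funext => y; rewrite -{2}[y]vsubmxK mul_block_col !mx_simp mulNmx.
  rewrite /ns_dae linear0 mulmx0 add0r !add_col_mx addr0.
  congr col_mx; rewrite [RHS]addrC //; congr (_ - _); exact: addrC.
apply: DiffDef; first exact: D1.
apply: (etrans D2); apply/funext => h.
rewrite /= add0r -[h]vsubmxK !mul_block_col !mx_simp add_col_mx.
by rewrite mul_convection_mx col_mxKu addr0 addrC.
Qed.

Lemma eq_mul_cV p q (A A' : 'M[R]_(p, q)) :
  (forall u : 'cV_q, A *m u = A' *m u) -> A = A'.
Proof.
move=> eqA; apply: trmx_inj; apply: eq_mul_rV => y.
by rewrite -[y]trmxK -!trmx_mul eqA.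
Qed.

Lemma eq_block_pad k l (W : 'M[R]_(k + l)) (A : 'M[R]_l) :
  (forall u : 'cV_(k + l), W *m u = col_mx 0 (A *m dsubmx u)) -> W = block_mx 0 0 0 A.
Proof.
move=> WE; apply: eq_mul_cV => u; rewrite WE -{2}[u]vsubmxK mul_block_col !mx_simp.
by [].
Qed.

(** Zero rows and columns produce neither equations nor constraints. *)
Lemma strangeness_free_pad (T : fieldType) k l (E A : 'M[T]_l) :
  strangeness_free E A ->
  strangeness_free (block_mx 0 0 0 E : 'M[T]_(k + l)) (block_mx 0 0 0 A).
Proof.
move=> free w; rewrite -[w]hsubmxK !mul_row_block !mx_simp => /row_mx0P[_ wE] wA.
rewrite [X in row_mx _ X]free ?row_mx0 // => x Ex.
have := wA (col_mx 0 x).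
by rewrite mul_block_col mul_row_col !mx_simp Ex col_mx0 => /(_ erefl).
Qed.

(** The identity between F and G is evaluated at differences in x' and
    differentiated in x. It shows that P F_x' Q and P F_x Q both have the form
    diag(0, _), with the matrices of G in the second place. *)
Lemma hypothesis0_redundancy (I : set R) N' (G : dae R N') :
  omits_redundancy I F G -> strangeness_hypothesis G I 0 ->
  exists v, strangeness_free (block_mx M 0 0 0)
    (block_mx (convection_mx K v) (- B^T) B 0).
Proof.
move=> [k [P [Q [h [nP nQ _ PFQ]]]]] hyp.
pose E0 : 'M[R]_N := block_mx M 0 0 0.
have PEQ t x (u : 'cV[R]_(k + N')) :
    P *m E0 *m Q *m u = P *m F t x (Q *m u) - P *m F t x 0.
  by rewrite -mulmxBr ns_dae_quasilinear addrK !mulmxA.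
have PFu t (x u : 'cV[R]_(k + N')) :
    P *m F t (Q *m x) (Q *m u) = col_mx (h t) (G t (dsubmx x) (dsubmx u)).
  by rewrite -(PFQ t (usubmx x) (usubmx u)) !vsubmxK.
have PF0 t x : P *m F t (Q *m x) 0 = col_mx (h t) (G t (dsubmx x) 0).
  by have := PFu t x 0; rewrite mulmx0 linear0.
have eQ t (x u : 'cV[R]_(k + N')) :
    P *m E0 *m Q *m u = col_mx 0 (G t (dsubmx x) (dsubmx u) - G t (dsubmx x) 0).
  by rewrite (PEQ t (Q *m x)) PFu PF0 opp_col_mx add_col_mx subrr.
pose E1 := drsubmx (P *m E0 *m Q).
have eE1 : P *m E0 *m Q = block_mx 0 0 0 E1.
  apply: eq_block_pad => u.
  have -> : P *m E0 *m Q *m u = P *m E0 *m Q *m col_mx 0 (dsubmx u).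
    by rewrite !(eQ 0 0) col_mxKd.
  rewrite -[LHS]vsubmxK {1}(eQ 0 0) col_mxKu; congr col_mx.
  by rewrite -{1}[P *m E0 *m Q]submxK mul_block_col col_mxKd !mx_simp.
have GE t y yd : G t y yd = E1 *m yd + G t y 0.
  have := eQ t (col_mx 0 y) (col_mx 0 yd).
  rewrite eE1 mul_block_col !col_mxKd !mx_simp => /eq_col_mx[_ ->].
  by rewrite subrK.
have mc p q : linear_maps_continuous 'M[R]_(p, q) by exact: mx_linear_maps_continuous.
have linP : linear (mulmx P : 'cV[R]_N -> 'cV[R]_(k + N')) by move=> a u v; rewrite linearP.
have linQ : linear (mulmx Q : 'cV[R]_(k + N') -> 'cV[R]_N) by move=> a u v; rewrite linearP.
have lind : linear (dsubmx : 'cV[R]_(k + N') -> 'cV[R]_N') by move=> a u v; rewrite linearP.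
have linup : linear (fun y : 'cV[R]_N' => col_mx 0 y : 'cV[R]_(k + N')).
  by move=> c u v; rewrite scale_col_mx add_col_mx scaler0 addr0.
have dPF t (u : 'cV[R]_(k + N')) : is_diff u (fun u => P *m F t (Q *m u) 0)
    (fun w => P *m (block_mx (convection_mx K (usubmx (Q *m u))) (- B^T) B 0 *m (Q *m w))).
  have [D1 D2] := is_diff_ns_dae t (Q *m u).
  have := is_diff_linear_post (mc _ _) linP (is_diff_linear_pre (x := u) (mc _ _) linQ D1).
  by rewrite D2.
have dG t y : differentiable (fun y => G t y 0) y.
  have [D1 _] := dPF t (col_mx 0 y).
  have [D _] := is_diff_linear_post (mc _ _) lind (is_diff_linear_pre (x := y) (mc _ _) linup D1).
  rewrite (_ : (fun y => _) = fun y => dsubmx (P *m F t (Q *m col_mx 0 y) 0)) //.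
  by apply/funext => y'; rewrite PF0 !col_mxKd.
have [t [y [A [dA free]]]] := hypothesis0_strangeness_free (Phi := fun t y => G t y 0) GE dG hyp.
exists (usubmx (Q *m col_mx 0 y)).
apply: (strangeness_free_equiv _ (strangeness_free_pad (k := k) free)).
apply: pair_equiv_sym; exists P, Q; split=> //.
apply/esym/eq_block_pad => w; have [_ D1] := dPF t (col_mx 0 y).
have dGy : differentiable (fun y => G t y 0) (dsubmx (col_mx (0 : 'cV[R]_k) y)).
  by rewrite col_mxKd.
have [_ D2] := is_diff_add (is_diff_cst (col_mx (h t) 0) (col_mx 0 y))
  (is_diff_linear_post (mc _ _) linup (is_diff_linear_pre (mc _ _) lind dGy)).
rewrite -!mulmxA -[LHS](congr1 (@^~ w) D1) -dA.
rewrite (_ : (fun u => _) = fun u => col_mx (h t) 0 + col_mx 0 (G t (dsubmx u) 0)).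
  by rewrite [LHS](congr1 (@^~ w) D2) /= add0r col_mxKd.
by apply/funext => u; rewrite PF0 add_col_mx addr0 add0r.
Qed.

End Redundancy.

(** * The index for B of full rank *)
Section FullRank.
Variables (R : realType) (n m : nat).
Variables (M : 'M[R]_n) (K : 'cV[R]_n -> 'cV[R]_n) (B : 'M[R]_(m, n)).
Variables (f : R -> 'cV[R]_n) (g : R -> 'cV[R]_m).
Hypothesis Msym : M^T = M.
Hypothesis Mpos : forall v : 'cV[R]_n, v != 0 -> 0 < (v^T *m M *m v) 0 0.
Hypothesis Ksmooth : smooth K.
Hypothesis fsmooth : smooth f.
Hypothesis gsmooth : smooth g.

Local Notation F := (ns_dae M K B f g).

Lemma ns_not_strangeness_hypothesis0 (I : set R) N' (G : dae R N') : B != 0 ->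
  omits_redundancy I F G -> ~ strangeness_hypothesis G I 0.
Proof.
move=> B0 omit /(hypothesis0_redundancy Ksmooth omit)[v].
exact: (ns_pencil_not_strangeness_free Mpos).
Qed.

Lemma omits_redundancy_refl (I : set R) N (G : dae R N) : omits_redundancy I G G.
Proof.
exists 0%N, (1%:M : 'M[R]_(0 + N, N)), (1%:M : 'M[R]_(N, 0 + N)), (fun=> 0).
split=> //; [exact: nonsingular1|exact: nonsingular1|].
by move=> t y0 ydot0 y ydot; rewrite !mul1mx !col_mx_nil.
Qed.

Lemma ns_strangeness_index (I : set R) :
  B != 0 -> \rank B = m -> (m <= n)%N -> I !=set0 ->
  [/\ strangeness_hypothesis_with F I 1 (2 * m) (n - m),
      ~ strangeness_hypothesis F I 0 & strangeness_index F I 1].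
Proof.
move=> B0 rB mn I0.
have h1 : strangeness_hypothesis_with F I 1 (2 * m) (n - m).
  by apply: ns_strangeness_hypothesis1 => //; apply: jet_solutions_nonempty.
have h0 : ~ strangeness_hypothesis F I 0.
  by apply: ns_not_strangeness_hypothesis0 B0 _; apply: omits_redundancy_refl.
split=> //; split; first by exists (2 * m)%N, (n - m)%N.
by case=> // _; apply: h0.
Qed.

End FullRank.

(** * Reduction to full rank *)
Section RankDeficient.
Variables (R : realType) (n m b : nat).
Variables (M : 'M[R]_n) (K : 'cV[R]_n -> 'cV[R]_n) (B : 'M[R]_(m, n)).
Variables (f : R -> 'cV[R]_n) (g : R -> 'cV[R]_m).
Variables (C0 : 'M[R]_(m, m - b)) (C' : 'M[R]_(m, b)) (Cinv : 'M[R]_(m - b + b, m)).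
Hypothesis rB : \rank B = b.
Hypothesis BC0 : B^T *m C0 = 0.
Local Notation C := (row_mx C0 C').
Hypothesis CCinv : C *m Cinv = 1%:M.
Hypothesis CinvC : Cinv *m C = 1%:M.
Local Notation Bt := (B^T *m C')^T.
Local Notation g1 := (fun t => usubmx (C^T *m g t)).
Local Notation g2 := (fun t => dsubmx (C^T *m g t)).

Lemma reduced_constraint : B^T *m C = row_mx 0 Bt^T.
Proof. by rewrite mul_mx_row BC0 trmxK. Qed.

Lemma reduced_rank : \rank Bt = b.
Proof.
rewrite mxrank_tr; have <- : \rank (B^T *m C) = \rank (B^T *m C').
  by rewrite mul_mx_row BC0 rank_row_0mx.
have freeC : row_free C by apply/row_freeP; exists Cinv.
by rewrite mxrankMfree // mxrank_tr.
Qed.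

Lemma reduced_constraint_tr : C^T *m B = col_mx 0 Bt.
Proof. by apply: trmx_inj; rewrite trmx_mul trmxK reduced_constraint tr_col_mx trmx0. Qed.

Lemma ns_solution_change (I : set R) v p :
  ns_solution M K B f g I v p <->
  ns_solution M K (col_mx 0 Bt) f (fun t => C^T *m g t) I v (fun t => Cinv *m p t).
Proof.
have eB t : (col_mx 0 Bt)^T *m (Cinv *m p t) = B^T *m p t.
  by rewrite tr_col_mx trmx0 -reduced_constraint -mulmxA [C *m _]mulmxA CCinv mul1mx.
split=> sol t It; have [dv dyn con] := sol t It; split=> //.
- by rewrite eB.
- by rewrite -reduced_constraint_tr -mulmxA con.
- by rewrite -eB.
- have : Cinv^T *m (C^T *m (B *m v t)) = Cinv^T *m (C^T *m g t).
    by rewrite [C^T *m (B *m _)]mulmxA reduced_constraint_tr con.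
  by rewrite !mulmxA -trmx_mul CCinv trmx1 !mul1mx.
Qed.

Lemma consistency (I : set R) t : ns_solvable M K B f g I -> I t -> g1 t = 0.
Proof.
move=> [v [p sol]] It; have [_ _ <-] := sol t It.
by rewrite mulmxA reduced_constraint_tr mul_col_mx mul0mx col_mxKu.
Qed.

Lemma ns_solution_omit (I : set R) v (pt1 : R -> 'cV[R]_(m - b)) (pt2 : R -> 'cV[R]_b) :
  (forall t, I t -> g1 t = 0) ->
  ns_solution M K (col_mx 0 Bt) f (fun t => C^T *m g t) I
    v (fun t => col_mx (pt1 t) (pt2 t)) <->
  ns_solution M K Bt f g2 I v pt2.
Proof.
move=> g10.
have eB t : (col_mx 0 Bt)^T *m col_mx (pt1 t) (pt2 t) = Bt^T *m pt2 t.
  by rewrite tr_col_mx trmx0 mul_row_col mul0mx add0r.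
split=> sol t It; have [dv dyn con] := sol t It; split=> //.
- by rewrite -eB.
- by have := congr1 dsubmx con; rewrite mul_col_mx col_mxKd.
- by rewrite eB.
- by rewrite mul_col_mx mul0mx con -[in LHS](g10 t It) vsubmxK.
Qed.

(** The change of unknowns (pt1, (v, pt2)) -> (v, C0 pt1 + C' pt2); its transpose
    is the change of equations. *)
Lemma reduction_nonsingular :
  nonsingular (row_mx (col_mx (0 : 'M[R]_(n, m - b)) C0) (block_mx 1%:M 0 0 C')).
Proof.
have := CCinv; have := CinvC; rewrite -[Cinv]vsubmxK mul_col_row mul_row_col.
move: (usubmx Cinv) (dsubmx Cinv) => D0 D'.
rewrite scalar_mx_block => /eq_block_mx[d00 d01 d10 d11] cd.
apply/nonsingularP; exists (col_mx (row_mx 0 D0) (block_mx 1%:M 0 0 D')); split.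
  rewrite mul_row_col mul_col_row mulmx_block !mx_simp add_block_mx !mx_simp.
  by rewrite cd -scalar_mx_block.
rewrite mul_col_row mulmx_block mul_row_col mul_row_block mul_block_col !mx_simp.
by rewrite d00 d01 d10 d11 row_mx0 col_mx0 -!scalar_mx_block.
Qed.

Lemma ns_omits_redundancy (I : set R) :
  (forall t, I t -> g1 t = 0) ->
  omits_redundancy I (ns_dae M K B f g) (ns_dae M K Bt f g2).
Proof.
move=> g10.
exists (m - b)%N.
pose Q := row_mx (col_mx (0 : 'M[R]_(n, m - b)) C0) (block_mx 1%:M 0 0 C').
have QT : Q^T = col_mx (row_mx 0 C0^T) (block_mx 1%:M 0 0 C'^T).
  by rewrite tr_row_mx tr_col_mx tr_block_mx !trmx0 trmx1.
exists Q^T, Q, (fun t => - g1 t); split.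
- by rewrite /nonsingular andbC /row_free /row_full !mxrank_tr; apply: reduction_nonsingular.
- exact: reduction_nonsingular.
- by move=> t It; rewrite g10 ?oppr0.
move=> t y0 ydot0 y ydot.
have Qy w0 w : Q *m col_mx w0 w = col_mx (usubmx w) (C0 *m w0 + C' *m dsubmx w).
  rewrite mul_row_col -[w in LHS]vsubmxK mul_block_col mul_col_mx !mx_simp.
  by rewrite add_col_mx add0r.
rewrite !Qy QT /ns_dae !col_mxKu !col_mxKd mul_col_mx mul_row_col mul_block_col !mx_simp.
have e2 : C'^T *m (B *m usubmx y - g t) = Bt *m usubmx y - g2 t.
  by rewrite tr_row_mx mul_col_mx col_mxKd trmx_mul trmxK mulmxBr mulmxA.
have e1 : C0^T *m (B *m usubmx y - g t) = - g1 t.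
  rewrite tr_row_mx mul_col_mx col_mxKu mulmxBr mulmxA -[C0^T *m B]trmxK trmx_mul trmxK.
  by rewrite BC0 trmx0 mul0mx sub0r.
rewrite e1 e2; congr (col_mx _ (col_mx _ _)).
by rewrite mulmxDr !mulmxA BC0 mul0mx add0r trmxK.
Qed.

End RankDeficient.

(** C^T is the left factor P of the rank normal form P B Q of B, with its first b
    rows moved to the end. *)
Lemma kernel_splitting (R : realType) (n m b : nat) (B : 'M[R]_(m, n)) : \rank B = b ->
  exists (C0 : 'M[R]_(m, m - b)) (C' : 'M[R]_(m, b)) (Cinv : 'M[R]_(m - b + b, m)),
    [/\ B^T *m C0 = 0, row_mx C0 C' *m Cinv = 1%:M & Cinv *m row_mx C0 C' = 1%:M].
Proof.
move=> rB; have [z [d [P [Q [/nonsingularP[P' [PP' P'P]] /nonsingularP[Q' [QQ' _]] PBQ]]]]] :=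
  rank_normal_form B.
rewrite rB in P P' PP' P'P Q Q' QQ' PBQ.
have zE : (m - b)%N = z.
  have : (b + z)%N = m.
    have rP : row_free P by apply/row_freeP; exists P'.
    have rP' : row_free P' by apply/row_freeP; exists P.
    apply/eqP; rewrite eqn_leq -{1}(eqP rP) rank_leq_col -{1}(eqP rP') rank_leq_col.
    by [].
  by move=> <-; rewrite addKn.
rewrite zE; exists (dsubmx P)^T, (usubmx P)^T, (col_mx (rsubmx P')^T (lsubmx P')^T); split.
- apply: trmx_inj; rewrite trmx_mul !trmxK trmx0.
  have : dsubmx P *m B *m Q = 0.
    have := congr1 dsubmx PBQ; rewrite -{1}[P]vsubmxK !mul_col_mx col_mxKd => ->.
    by rewrite block_mxEv col_mxKd row_mx0.
  by move=> /(congr1 (mulmx^~ Q')); rewrite -mulmxA QQ' mulmx1 mul0mx.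
- rewrite mul_row_col -!trmx_mul -raddfD /= addrC -mul_row_col hsubmxK vsubmxK P'P.
  by rewrite trmx1.
- have : P *m P' = 1%:M by [].
  rewrite -{1}[P]vsubmxK -{1}[P']hsubmxK mul_col_row scalar_mx_block.
  move=> /eq_block_mx[e1 e2 e3 e4].
  by rewrite mul_col_row -!trmx_mul e1 e2 e3 e4 !trmx0 !trmx1 -scalar_mx_block.
Qed.

(** * The strangeness index and the differentiation index *)
Theorem mainTheorem1 (R : realType) (n m : nat) (hmn : (m < n)%N)
    (M : 'M[R]_n) (Msym : M^T = M)
    (Mpos : forall v : 'cV[R]_n, v != 0 -> 0 < (v^T *m M *m v) 0 0)
    (B : 'M[R]_(m, n)) (B0 : B != 0) :
  (* (i) *)
  (forall K : 'M[R]_n,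
    pair_strangeness_index (block_mx M 0 0 0) (block_mx (- K) B^T B 0) 1) /\
  forall (I : set R) (Iitv : is_interval I)
    (Inondeg : exists t0 t1, [/\ I t0, I t1 & t0 < t1])
    (K : 'cV[R]_n -> 'cV[R]_n) (f : R -> 'cV[R]_n) (g : R -> 'cV[R]_m)
    (Ksmooth : smooth_on setT K) (fsmooth : smooth_on setT f)
    (gsmooth : smooth_on setT g),
  let F := ns_dae M K B f g in
  [/\ (* (ii) *)
      \rank B = m ->
        [/\ strangeness_hypothesis_with F I 1 (2 * m) (n - m),
            ~ strangeness_hypothesis F I 0
          & strangeness_index F I 1],
      (* (iii) *)
      forall b : nat, \rank B = b -> (b < m)%N ->
        (forall (C0 : 'M[R]_(m, m - b)) (C' : 'M[R]_(m, b))
           (Cinv : 'M[R]_(m - b + b, m)),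
          \rank C0 = (m - b)%N -> B^T *m C0 = 0 ->
          let C := row_mx C0 C' in
          C *m Cinv = 1%:M -> Cinv *m C = 1%:M ->
          let Bt := (B^T *m C')^T in
          let g1 := fun t => usubmx (C^T *m g t) in
          let g2 := fun t => dsubmx (C^T *m g t) in
          let G := ns_dae M K Bt f g2 in
          [/\ B^T *m C = row_mx 0 Bt^T /\ \rank Bt = b,
              forall v p,
                ns_solution M K B f g I v p <->
                ns_solution M K (col_mx 0 Bt) f (fun t => C^T *m g t) I
                  v (fun t => Cinv *m p t),
              ns_solvable M K B f g I ->
                [/\ forall t, I t -> g1 t = 0,
                    forall v (pt1 : R -> 'cV[R]_(m - b)) (pt2 : R -> 'cV[R]_b),
                      ns_solution M K (col_mx 0 Bt) f (fun t => C^T *m g t) I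
                        v (fun t => col_mx (pt1 t) (pt2 t)) <->
                      ns_solution M K Bt f g2 I v pt2
                  & omits_redundancy I F G]
            & [/\ strangeness_hypothesis_with G I 1 (2 * b) (n - b),
                  ~ strangeness_hypothesis G I 0
                & strangeness_index G I 1]]) /\
        (ns_solvable M K B f g I -> strangeness_index_mod_redundancy F I 1),
      (* differentiation index *)
      (exists nu, differentiation_index F I nu) <-> \rank B = m
    & \rank B = m -> differentiation_index F I 2].

Proof.
split=> [K|I _ [t0 [_ [It0 _ _]]] K f g Ksmooth fsmooth gsmooth F].
  exact: ns_pencil_index.
have I0 : I !=set0 by exists t0.
have rB0 : (0 < \rank B)%N by rewrite lt0n mxrank_eq0.
have m0 : (0 < m)%N := leq_trans rB0 (rank_leq_row B).
have diff2 : \rank B = m -> differentiation_index F I 2.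
  by move=> rB; apply: ns_differentiation_index.
split=> //.
- by move=> rB; apply: ns_strangeness_index => //; apply: ltnW.
- move=> b rB bm.
  have b0 : (0 < b)%N by rewrite -rB.
  have bn : (b <= n)%N by rewrite ltnW // (ltn_trans bm).
  have reduced_index (C0 : 'M[R]_(m, m - b)) (C' : 'M[R]_(m, b)) (Cinv : 'M[R]_(m - b + b, m)) :
      B^T *m C0 = 0 -> row_mx C0 C' *m Cinv = 1%:M ->
      let G := ns_dae M K (B^T *m C')^T f (fun t => dsubmx ((row_mx C0 C')^T *m g t)) in
      [/\ strangeness_hypothesis_with G I 1 (2 * b) (n - b),
          ~ strangeness_hypothesis G I 0 & strangeness_index G I 1].
    move=> BC0 CCinv G; have rBt := reduced_rank rB BC0 CCinv.
    apply: ns_strangeness_index => //.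
    - pose L (u : 'cV[R]_m) := dsubmx ((row_mx C0 C')^T *m u).
      apply: (smooth_linear_post (L := L)) => //; first exact: mx_linear_maps_continuous.
      by move=> a u v; rewrite /L !linearP.
    - by rewrite -mxrank_eq0 rBt -lt0n.
  split=> [C0 C' Cinv _ BC0 C CCinv CinvC Bt g1 g2 G|solv].
    split.
    - by split; [apply: reduced_constraint|apply: reduced_rank CCinv].
    - by move=> v p; apply: ns_solution_change.
    - move=> solv; have g10 t : I t -> g1 t = 0 by apply: consistency solv.
      split=> //.
      + by move=> v pt1 pt2; apply: ns_solution_omit.
      + by apply: (ns_omits_redundancy M K f BC0 CCinv CinvC).
    - exact: reduced_index CCinv.
  split; last first.
    case=> // _ [N' [G [omit hyp]]].
    exact: (ns_not_strangeness_hypothesis0 Mpos Ksmooth B0 omit hyp).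
  have [C0 [C' [Cinv [BC0 CCinv CinvC]]]] := kernel_splitting rB.
  have [h1 _ _] := reduced_index _ _ _ BC0 CCinv.
  exists (n + b)%N, (ns_dae M K (B^T *m C')^T f (fun t => dsubmx ((row_mx C0 C')^T *m g t))).
  split; last by exists (2 * b)%N, (n - b)%N.
  apply: (ns_omits_redundancy M K f BC0 CCinv CinvC) => t.
  exact: consistency solv.
- split=> [[nu [ode _]]|rB]; last by exists 2; apply: diff2.
  apply/eqP; rewrite eqn_leq rank_leq_row leqNgt; apply/negP => rBm.
  exact: (no_explicit_ode_deficient Ksmooth fsmooth gsmooth rBm ode).
Qed.
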